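(* Let $m\geq 1$ be an integer, let $p \neq \ell$ be primes, and let $\left(\frac{\cdot}{\ell}\right)$ denote the Legendre symbol. \begin{enumerate} \item Let $\delta\mid 24$, let $m$ be odd, and let $p$ satisfy (a) $p + 1\mid 24/\delta$, (b) $\frac{24/\delta}{p + 1} = p^t$ or $3p^t$ for some $t\geq 0$, (c) $p\nmid \delta$. Let $r_{p, m} = \frac{p^m + 1}{p + 1}\in \mathbb{Z}$. Then for all primes $\ell \neq p$ with $\ell \nmid \delta$ and $\left(\frac{-p}{\ell}\right) = -1$, we have $\widetilde{D}_{\delta}(z)^{r_{p,m}}\mid T_{\ell} = 0$ in $\mathbb{F}_{p}[[q]]$. The set of $(\delta, p)$ satisfying conditions (a), (b), (c) is $$\{(1, 2), (1, 7), (1, 23), (2, 3), (2, 11), (3, 7), (4, 5)\}.$$ \item Let $d\mid 24$ and let $p$ satisfy (a) $24/d = p^t$ or $3p^t$ for some $t\geq 0$, (b) $p\nmid d$. Then for all primes $\ell \neq p$ with $\ell\nmid d$ and $$-1 = \left(\frac{-p^m}{\ell}\right) = \begin{cases} \left(\frac{-p}{\ell}\right), & m \text{ odd}, \\ \left(\frac{-1}{\ell}\right), & m \text{ even}, \end{cases}$$ we have $\widetilde{D}_{d}(z)^{p^m + 1}\mid T_{\ell} = 0$ in $\mathbb{F}_{p}[[q]]$. The set of $(d, p)$ satisfying conditions (a) and (b) is $$\{(1, 2), (3, 2)\}\cup \{(8, p) : p\geq 3 \text{ prime}\} \cup \{(24, p) : p\geq 5 \text{ prime}\}.$$ \end{e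numerate}
   Context: Let $q=e^{2\pi i z}$, $\eta(z)=q^{1/24}\prod_{n\ge1}(1-q^n)$, and for $\delta\mid24$ let $D_\delta(z)=\eta(\delta z)^{24/\delta}\in q\,\mathbb{Z}[[q]]$. Then $D_\delta$ is a cusp form of weight $12/\delta$: for $\delta\notin\{8,24\}$ it lies in $S_{12/\delta}\left(\Gamma_0(\delta^2),\left(\frac{(-1)^{12/\delta}\delta^{24/\delta}}{\cdot}\right)\right)$ (so the character is trivial for $\delta\in\{1,2,3\}$ and is $\left(\frac{-4}{\cdot}\right)$ for $\delta=4$); $D_8\in S_{3/2}\left(\Gamma_0(64),\left(\frac{-4}{\cdot}\right)\right)$ and $D_{24}\in S_{1/2}\left(\Gamma_0(576),\left(\frac{12}{\cdot}\right)\right)$, with respect to the theta-multiplier system as in Shimura's theory. For $d\in\{8,24\}$ and $p$ odd, the exponent $p^m+1$ is even, so $D_d^{p^m+1}$ has integer weight $w=\frac{12}{d}(p^m+1)$, and its character is $\left(\frac{-4}{\cdot}\right)^{w}$. $\widetilde f\in\mathbb{F}_p[[q]]$ denotes the coefficientwise reduction modulo $p$ of $f\in\mathbb{Z}[[q]]$. For a form $f=\sum c(n)q^n$ of integer weight $w$, level $N$ and character $\chi$ and a prime $\ell\nmid N$, the Hecke operator is $f\mid T_\ell=\sum_n(c(\ell n)+\chi(\ell)\ell^{w-1}c(n/\ell))q^n$, with $c(n/\ell)=0$ if $\ell\nmid n$; and $\widetilde f\mid T_\ell$ means the reduction modulo $p$ of $f\mid T_\ell$, where here $f$ is $D_\delta^{r_{p,m}}$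 or $D_d^{p^m+1}$ with its own weight and character. *)

(* Defs.v *)
(* Formal power series in q are represented by their coefficient sequences. *)
From HB Require Import structures.
From mathcomp Require Import all_boot all_order all_algebra.
Set Implicit Arguments.
Unset Strict Implicit.
Unset Printing Implicit Defensive.
Import Order.TTheory GRing.Theory Num.Theory.
Local Open Scope ring_scope.

Definition fps (R : Type) := nat -> R.

Definition fps_one : fps int := fun n => (n == 0%N)%:R.

Definition fps_mul (f g : fps int) : fps int :=
  fun n => \sum_(i < n.+1) f i * g (n - i)%N.

Definition fps_exp (f : fps int) (k : nat) : fps int :=
  iter k (fps_mul f) fps_one.

(* f(q) |-> q * f(q) *)
Definition fps_mulq (f : fps int) : fps int :=
  fun n => if n is n'.+1 then f n' else 0.

(* f(q) |-> f(q^d), for d > 0 *)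
Definition fps_subst (d : nat) (f : fps int) : fps int :=
  fun n => if (d %| n)%N then f (n %/ d)%N else 0.

Definition fps_mod (p : nat) (f : fps int) : fps 'F_p := fun n => (f n)%:~R.

(* prod_{k >= 1} (1 - q^k): only the factors with k <= n contribute to the
   coefficient of q^n, see euler_product_stable. *)
Definition euler_product : fps int :=
  fun n => (\prod_(1 <= k < n.+1) (1 - 'X^k : {poly int}))`_n.

Lemma euler_product_stable (n N : nat) : (n <= N)%N ->
  (\prod_(1 <= k < N.+1) (1 - 'X^k : {poly int}))`_n = euler_product n.
Proof.
elim: N => [|N IHN]; first by rewrite leqn0 => /eqP ->.
rewrite leq_eqVlt => /orP[/eqP -> //|ltnN].
by rewrite big_nat_recr //= mulrBr mulr1 coefB coefMXn ltnN subr0 IHN.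
Qed.

(* D_delta(z) = eta(delta z)^(24/delta) for delta | 24; the prefactor q^(1/24)
   of eta becomes (q^(delta/24))^(24/delta) = q. *)
Definition D (delta : nat) : fps int :=
  fps_mulq (fps_exp (fps_subst delta euler_product) (24 %/ delta)).

(* The Legendre symbol (a / l), for l prime. At l = 2, where it is usually left
   undefined, this gives 0 or 1 and never -1. *)
Definition legendre (a : int) (l : nat) : int :=
  let b : 'F_l := a%:~R in
  if b == 0 then 0 else if [exists x : 'F_l, x ^+ 2 == b] then 1 else -1.

Definition kronecker_prime (a : int) (l : nat) : int :=
  if l == 2%N then
    if (2 %| a)%Z then 0
    else if ((a %% 8)%Z == 1) || ((a %% 8)%Z == 7) then 1 else -1
  else legendre a l.

(* The Kronecker symbol (a / n), for n >= 0. *)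
Definition kronecker (a : int) (n : nat) : int :=
  if n == 0%N then (`|a| == 1)%:R
  else \prod_(f <- prime_decomp n) kronecker_prime a f.1 ^+ f.2.

(* Weight of D_delta^k, when 12 k / delta is an integer. *)
Definition D_weight (delta k : nat) : nat := (12 * k %/ delta)%N.

(* Character of D_delta^k. For delta = 8, 24 the form D_delta has half-integral
   weight, and this is the character of its even powers. *)
Definition D_char (delta k : nat) : nat -> int := fun n =>
  if (delta == 8%N) || (delta == 24%N) then
    kronecker (- 4%:Z) n ^+ D_weight delta k
  else
    kronecker ((-1) ^+ (12 %/ delta) * delta%:Z ^+ (24 %/ delta)) n ^+ k.

(* T_l on forms of weight w >= 1 and character chi. *)
Definition hecke (w : nat) (chi : nat -> int) (l : nat) (c : fps int) :
    fps int :=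
  fun n => c (l * n)%N
    + chi l * l%:Z ^+ w.-1 * (if (l %| n)%N then c (n %/ l)%N else 0).

(* D_delta^k | T_l, with the weight and character of D_delta^k. *)
Definition D_hecke (delta k l : nat) : fps int :=
  hecke (D_weight delta k) (D_char delta k) l (fps_exp (D delta) k).

Definition cond_abc (delta p : nat) : Prop :=
  [/\ (p + 1 %| 24 %/ delta)%N,
      exists t : nat, ((24 %/ delta) %/ (p + 1) = p ^ t)%N
                   \/ ((24 %/ delta) %/ (p + 1) = 3 * p ^ t)%N
    & ~~ (p %| delta)%N].

Definition cond_ab (d p : nat) : Prop :=
  (exists t : nat, (24 %/ d = p ^ t)%N \/ (24 %/ d = 3 * p ^ t)%N)
  /\ ~~ (p %| d)%N.

Definition r_ (p m : nat) : nat := ((p ^ m + 1) %/ (p + 1))%N.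

(* Main.v *)
Require Import Defs.
From mathcomp Require Import all_boot all_order all_algebra.
From mathcomp Require Import cyclic finfield.
From mathcomp Require Import zify ring.
Import Order.TTheory GRing.Theory Num.Theory.
Local Open Scope ring_scope.

(** Write P = prod_(n >= 1) (1 - q^n).  In every case of the proposition the
    power k of D_delta satisfies k * (24 / delta) = e * p^t * (p^m + 1) with e = 1
    or e = 3, so that, Frobenius being additive modulo p,
      D_delta^k  = q^k * P(q^delta)^(e * p^t * (p^m + 1))
                == q^k * A(q^(delta * p^(t+m))) * A(q^(delta * p^t)),   A = P^e.
    For these two exponents A is a theta series: by Euler's pentagonal theorem
    q^(1/24) * P(q) = sum chi12(x) q^(x^2/24), and by Jacobi's identity
    q^(1/8) * P(q)^3 = sum chi4(x) x q^(x^2/8), both over x >= 1.  With c = 24 / e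
    and psi = chi12, respectively psi(x) = chi4(x) x, the coefficient of q^n in
    D_delta^k is therefore modulo p the sum of psi(x) psi(y) over the solutions of
      delta * p^t * (p^m x^2 + y^2) = c * n       (D_exp_mod_coef).

    If - p^m is not a square modulo l, the form p^m x^2 + y^2 is anisotropic modulo
    l: a solution for l * n has l | x and l | y, hence l | n, and dividing x and y
    by l maps the solutions for l * n to those for n / l.  So the coefficient of
    q^(l * n) is 0 when l does not divide n, and is psi(l)^2 = l^(e-1) times the
    coefficient of q^(n/l) otherwise.  The Hecke operator then kills D_delta^k as
    soon as
      l^(e-1) + chi(l) * l^(w-1) = 0 modulo p     (D_hecke_vanish),
    w and chi being the weight and the character of D_delta^k.

    For p = 2 this holds by parity.  For odd p one can take t = 0; then
    w = e (p^m + 1) / 2 and chi(l) = (-1/l)^w, and Euler's criterion turns the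
    condition into an equation between signs (character_condition): for even m it
    is (-1/l) = -1, and for odd m it is (-1/l)^((p+1)/2) (l/p) = -1, which is
    (-p/l) = -1 by quadratic reciprocity. *)

Set Implicit Arguments.
Unset Strict Implicit.
Unset Printing Implicit Defensive.

(** * Quadratic reciprocity by Gauss sums *)

Lemma finField_prim_root (F : finFieldType) : {z : F | #|F|.-1.-primitive_root z}.
Proof.
apply/sigW.
have q1 := finNzRing_gt1 F.
have : has #|F|.-1.-primitive_root (enum (predC1 (0 : F))).
  apply: has_prim_root; first by rewrite -ltnS prednK // ltnW.
  - apply/allP=> x; rewrite mem_enum => x0.
    apply/unity_rootP; apply: (mulfI x0).
    by rewrite -exprS prednK ?(ltnW q1) // expf_card mulr1.
  - exact: enum_uniq.
  - by rewrite -cardE cardC1.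
by case/hasP=> z _ zP; exists z.
Qed.

(** At the class of a in 'F_l this is the Legendre symbol legendre a l, by
    conversion. *)
Definition quadratic_character {F : finFieldType} (b : F) : int :=
  if b == 0 then 0 else if [exists x : F, x ^+ 2 == b] then 1 else -1.

(** A generator g of the multiplicative group makes both sides explicit: g^i is a
    square exactly when i is even, exactly when g^(i (#|F| - 1) / 2) = 1. *)
Lemma euler_criterion (F : finFieldType) (b : F) : odd #|F| ->
  (quadratic_character b)%:~R = b ^+ (#|F|./2).
Proof.
set h := #|F|./2 => oddF; have q1 := finNzRing_gt1 F.
have qE : #|F|.-1 = (2 * h)%N.
  by rewrite -[in LHS](odd_double_half #|F|) oddF -mul2n.
have h0 : (0 < h)%N.
  have : (0 < #|F|.-1)%N by rewrite -ltnS prednK // ltnW.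
  by rewrite qE muln_gt0.
have sqr_h (x : F) : x != 0 -> (x ^+ 2) ^+ h = 1.
  move=> x0; apply: (mulfI x0).
  by rewrite -exprM -qE -exprS prednK ?(ltnW q1) // expf_card mulr1.
rewrite /quadratic_character; case: eqVneq => [->|b0].
  by rewrite expr0n gtn_eqF.
case: existsP => [[x /eqP xb]|nsq].
  by rewrite -xb sqr_h //; apply: contraNneq b0 => x0; rewrite -xb x0 expr0n.
have [g gP] := finField_prim_root F.
have [i bE] : exists i, b = g ^+ i.
  suff /(prim_rootP gP)[i ->] : b ^+ #|F|.-1 = 1 by exists i.
  apply: (mulfI b0).
  by rewrite -exprS prednK ?(ltnW q1) // expf_card mulr1.
have /eqP : (b ^+ h) ^+ 2 = 1 by rewrite -exprM mulnC exprM sqr_h.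
rewrite sqrf_eq1 => /orP[/eqP bh|/eqP -> //]; case: nsq.
move: (bh); rewrite bE -exprM => /eqP; rewrite -(prim_order_dvd gP) qE.
rewrite dvdn_pmul2r // => /dvdnP[j iE]; exists (g ^+ j).
by rewrite iE -exprM.
Qed.

(** Euler's criterion and Gauss sums compute signs inside a finite field; this
    brings the resulting identities back to the integers. *)
Lemma sign_intr_inj (F : fieldType) (x y : int) : (2%:R != 0 :> F) ->
  x \in [:: 0; 1; -1] -> y \in [:: 0; 1; -1] -> x%:~R = y%:~R :> F -> x = y.
Proof.
move=> F2; have F1 := oner_neq0 F; rewrite !inE.
have FN : (1 == -1 :> F) = false by rewrite -addr_eq0 (negPf F2).
case/or3P=> /eqP -> /or3P[] /eqP -> //; rewrite ?mulr0z ?mulrN1z ?mulr1z => /eqP;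
  by rewrite ?(eq_sym 0) ?oppr_eq0 ?(eq_sym (-1) 1) ?FN ?(negPf F1).
Qed.

Lemma sign_expr_odd (x : int) j : x ^+ 2 = 1 -> x ^+ j = x ^+ odd j.
Proof. by move=> x2; rewrite -{1}[j]odd_double_half exprD -mul2n exprM x2 expr1n mulr1. Qed.

Lemma quadratic_character_sign (F : finFieldType) (b : F) :
  quadratic_character b \in [:: 0; 1; -1].
Proof. by rewrite /quadratic_character; case: ifP => // _; case: ifP. Qed.

Section GaussSum.

Variable p : nat.
Hypotheses (pr_p : prime p) (odd_p : odd p).

Local Notation eta := (@quadratic_character 'F_p).

Lemma Fp_two_neq0 : 2%:R != 0 :> 'F_p.
Proof.
rewrite -(dvdn_pcharf (pchar_Fp pr_p)).
apply/negP=> /dvdn_leq p_le2; have := prime_gt1 pr_p; have := odd_p.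
by case: p p_le2 => [|[|[|n]]] // /(_ isT).
Qed.

Lemma euler_criterion_Fp (b : 'F_p) : (eta b)%:~R = b ^+ p./2.
Proof. by have := euler_criterion b; rewrite card_Fp //; apply. Qed.

Lemma quadratic_characterM (a b : 'F_p) : eta (a * b) = eta a * eta b.
Proof.
apply: (sign_intr_inj Fp_two_neq0); first exact: quadratic_character_sign.
  have := (quadratic_character_sign a, quadratic_character_sign b).
  by rewrite !inE => -[/or3P[] /eqP -> /or3P[] /eqP ->].
by rewrite rmorphM /= !euler_criterion_Fp exprMn.
Qed.

Lemma quadratic_character_sqr (a : 'F_p) : a != 0 -> eta a ^+ 2 = 1.
Proof.
move=> a0; rewrite /quadratic_character (negPf a0).
by case: ifP; rewrite ?expr1n ?sqrrN.
Qed.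

(** Multiplication by a generator, which is a nonsquare, changes the sign of the
    sum. *)
Lemma quadratic_character_sum0 : \sum_(a : 'F_p) eta a = 0.
Proof.
have [g gP] := finField_prim_root 'F_p; rewrite card_Fp // in gP.
have p1 := prime_gt1 pr_p.
have pE : p.-1 = (2 * p./2)%N by rewrite -[in LHS](odd_double_half p) odd_p -mul2n.
have g0 : g != 0.
  apply/eqP=> g0; have /eqP := prim_expr_order gP.
  by rewrite g0 expr0n gtn_eqF ?(prim_order_gt0 gP) // eq_sym oner_eq0.
have eta_g : eta g = -1.
  have := euler_criterion_Fp g.
  rewrite /quadratic_character (negPf g0); case: ifP => // _ /esym/eqP.
  rewrite rmorph1 -(prim_order_dvd gP) pE => /dvdn_leq.
  by lia.
have : \sum_(a : 'F_p) eta a = - \sum_(a : 'F_p) eta a.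
  rewrite -mulN1r -eta_g {1}(reindex_inj (mulfI g0)) mulr_sumr /=.
  by apply: eq_bigr => a _; rewrite quadratic_characterM.
by lia.
Qed.

Variables (K : fieldType) (zeta : K).
Hypothesis zetaP : p.-primitive_root zeta.

Definition additive_character (a : 'F_p) : K := zeta ^+ nat_of_ord a.

Local Notation e := additive_character.

Lemma additive_characterD (a b : 'F_p) : e (a + b) = e a * e b.
Proof.
rewrite /e.
have -> : nat_of_ord (a + b) = ((nat_of_ord a + nat_of_ord b) %% p)%N.
  by rewrite -{1}[a]natr_Zp -{1}[b]natr_Zp -natrD val_Fp_nat.
by rewrite (prim_expr_mod zetaP) exprD.
Qed.

(** For c != 0 the sum is invariant under multiplication by zeta != 1. *)
Lemma additive_character_sum (c : 'F_p) :
  \sum_(a : 'F_p) e (a * c) = if c == 0 then p%:R else 0.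
Proof.
case: eqVneq => [->|c0].
  by under eq_bigr do rewrite mulr0; rewrite sumr_const card_Fp.
have e1 : e 1 != 1.
  rewrite /e (@val_Fp_nat p pr_p 1) modn_small ?prime_gt1 //.
  by rewrite -(prim_order_dvd zetaP) gtnNdvd ?prime_gt1.
have inj_c : injective (fun a : 'F_p => a * c) by apply: mulIf.
transitivity (\sum_(a : 'F_p) e a); first by rewrite [RHS](reindex_inj inj_c).
set S := \sum_a _; have : e 1 * S = S.
  rewrite {2}/S (reindex_inj (addrI (1 : 'F_p))) mulr_sumr.
  by apply: eq_bigr => a _; rewrite additive_characterD.
move/eqP; rewrite -subr_eq0 -{2}[S]mul1r -mulrBl mulf_eq0 subr_eq0 (negPf e1).
by move/eqP.
Qed.

Definition gauss_sum : K := \sum_(a : 'F_p) (eta a)%:~R * e a.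

(** The substitution b = a c in the double sum makes the inner sum over a a sum
    of an additive character, equal to p - 1 for c = -1 and to -1 otherwise. *)
Lemma gauss_sum_sqr : gauss_sum ^+ 2 = (eta (-1))%:~R * p%:R.
Proof.
have -> : gauss_sum ^+ 2 =
    \sum_(c : 'F_p) (eta c)%:~R * \sum_(a | a != 0) e (a * (1 + c)).
  rewrite expr2 {1}/gauss_sum mulr_suml (bigID (fun a : 'F_p => a == 0)) /=.
  rewrite big_pred1_eq {1}/quadratic_character eqxx !mul0r add0r.
  under [RHS]eq_bigr do rewrite mulr_sumr.
  rewrite [RHS]exchange_big; apply: eq_bigr => a a0 /=.
  rewrite /gauss_sum mulr_sumr [LHS](reindex_inj (mulfI a0)) /=.
  apply: eq_bigr => c _.
  have eta_a2 : (eta a)%:~R ^+ 2 = 1 :> K.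
    by rewrite -rmorphXn /= quadratic_character_sqr.
  rewrite quadratic_characterM mulrDr mulr1 additive_characterD intrM.
  transitivity ((eta a)%:~R ^+ 2 * ((eta c)%:~R * (e a * e (a * c)))); first by ring.
  by rewrite eta_a2 mul1r.
have sum1 (c : 'F_p) : \sum_(a | a != 0) e (a * (1 + c)) =
    (if c == -1 then p%:R else 0) - 1.
  have := additive_character_sum (1 + c).
  rewrite (bigD1 0) //= mul0r {1}/e expr0 addrC => /(canRL (addrK _)) ->.
  by rewrite [1 + c]addrC addr_eq0.
under eq_bigr do rewrite sum1 mulrBr mulr1.
rewrite sumrB -rmorph_sum quadratic_character_sum0 subr0 (bigD1 (-1)) //= eqxx.
by rewrite big1 ?addr0 // => c /negPf ->; rewrite mulr0.
Qed.

(** In characteristic l the l-th power is additive and fixes the integral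
    coefficients, so it only permutes the roots of unity of the sum. *)
Lemma gauss_sum_frobenius l : l \in [pchar K] -> odd l ->
  gauss_sum ^+ l = (eta l%:R)%:~R * gauss_sum.
Proof.
move=> charl oddl; have pr_l := pcharf_prime charl.
rewrite -(pFrobenius_autE charl) rmorph_sum.
have p0 : p%:R != 0 :> K := prim_root_natf_neq0 zetaP.
have l0 : l%:R != 0 :> 'F_p.
  rewrite -(dvdn_pcharf (pchar_Fp pr_p)) dvdn_prime2 //.
  by apply: contraNneq p0 => ->; rewrite pcharf0.
rewrite /gauss_sum mulr_sumr [RHS](reindex_inj (mulfI l0)).
apply: eq_bigr => a _; rewrite /= pFrobenius_autE exprMn.
rewrite -[X in X * _](pFrobenius_autE charl) pFrobenius_aut_int.
have -> : e a ^+ l = e (l%:R * a).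
  rewrite /e -{2}[a]natr_Zp -natrM val_Fp_nat // (prim_expr_mod zetaP).
  by rewrite -exprM mulnC.
by rewrite mulrA -intrM quadratic_characterM mulrA -expr2 quadratic_character_sqr ?mul1r.
Qed.

End GaussSum.

(** The law in the form (d/l) = (l/p), where d = (-1/p) p.  The Gauss sum tau
    over a field of characteristic l containing a p-th root of unity satisfies
    tau^2 = d and tau^l = (l/p) tau, so that d^((l-1)/2) = (l/p). *)
Theorem quadratic_reciprocity p l : prime p -> odd p -> prime l -> odd l ->
  p != l ->
  quadratic_character ((quadratic_character (-1 : 'F_p) * p%:Z)%:~R : 'F_l)
    = quadratic_character (l%:R : 'F_p).
Proof.
move=> pr_p odd_p pr_l odd_l npl.
have p1 : (0 < p.-1)%N by rewrite -ltnS prednK ?prime_gt0 ?prime_gt1.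
have [K charK cardK] := pPrimePowerField pr_l p1.
have [z zP] := finField_prim_root K.
have p_dvd : (p %| #|K|.-1)%N.
  rewrite cardK -subn1 -eqn_mod_dvd ?expn_gt0 ?prime_gt0 //.
  rewrite -(totient_prime pr_p); apply/eqP/Euler_exp_totient.
  by rewrite coprime_sym prime_coprime // dvdn_prime2.
have := dvdn_prim_root zP p_dvd; set zeta := _ ^+ _ => zetaP.
have := gauss_sum_frobenius pr_p odd_p zetaP charK odd_l.
rewrite -[l in LHS](odd_double_half l) odd_l exprS -mul2n exprM gauss_sum_sqr //.
have p0 : p%:R != 0 :> K by rewrite (prim_root_natf_neq0 zetaP).
have tau0 : gauss_sum p zeta != 0.
  suff: gauss_sum p zeta ^+ 2 != 0 by rewrite expf_eq0.
  rewrite gauss_sum_sqr // mulf_neq0 //.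
  rewrite /quadratic_character oppr_eq0 oner_eq0.
  by case: ifP; rewrite ?mulrN1z ?oppr_eq0 oner_eq0.
rewrite mulrC => /(mulIf tau0) eqK.
apply: (sign_intr_inj (Fp_two_neq0 pr_l odd_l)); rewrite ?quadratic_character_sign //.
rewrite euler_criterion_Fp //; apply/eqP.
rewrite -rmorphXn -subr_eq0 -rmorphB -(dvdz_pcharf (pchar_Fp pr_l)).
by rewrite (dvdz_pcharf charK) rmorphB rmorphXn rmorphM /= eqK subrr.
Qed.

(** * The Legendre symbol *)

Lemma Fp_nat_eq0 p n : prime p -> (n%:R == 0 :> 'F_p) = (p %| n)%N.
Proof. by move=> pr_p; rewrite -(dvdn_pcharf (pchar_Fp pr_p)). Qed.

Lemma legendre_sqr (a b : int) l : b%:~R != 0 :> 'F_l ->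
  legendre (a * b ^+ 2) l = legendre a l.
Proof.
move=> b0; rewrite /legendre rmorphM rmorphXn /= mulf_eq0 expf_eq0 /= (negPf b0) orbF.
case: ifP => // _; congr (if _ then _ else _).
apply/existsP/existsP => -[x /eqP xE].
  by exists (x / b%:~R); rewrite expr_div_n xE mulfK // expf_neq0.
by exists (x * b%:~R); rewrite exprMn xE.
Qed.

(** Every element of a field with two elements is a square. *)
Lemma legendre_odd (a : int) l : prime l -> legendre a l = -1 -> odd l.
Proof.
move=> pr_l; have [l2|//] := even_prime pr_l; rewrite l2 /legendre.
case: ifP => // _; case: existsP => // -[].
by exists a%:~R; have := expf_card (a%:~R : 'F_2); rewrite card_Fp // => ->.
Qed.

Lemma legendre_unit (a : int) l : a%:~R != 0 :> 'F_l -> legendre a l ^+ 2 = 1.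
Proof. by move=> a0; rewrite /legendre (negPf a0); case: ifP; rewrite ?expr1n ?sqrrN. Qed.

Lemma legendre1 l : legendre 1 l = 1.
Proof.
rewrite /legendre rmorph1 oner_eq0; case: existsP => // -[].
by exists 1; rewrite expr1n.
Qed.

Lemma legendre_neg_exp p m l : prime p -> prime l -> l <> p ->
  legendre (- p%:Z ^+ m) l
    = if odd m then legendre (- p%:Z) l else legendre (-1) l.
Proof.
move=> pr_p pr_l npl.
have p0 : p%:Z%:~R != 0 :> 'F_l.
  by rewrite -pmulrn Fp_nat_eq0 // dvdn_prime2 //; apply/eqP.
have pm0 j : (p%:Z ^+ j)%:~R != 0 :> 'F_l by rewrite rmorphXn expf_neq0.
rewrite -[m in p%:Z ^+ m]odd_double_half exprD -muln2 exprM -mulNr legendre_sqr //.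
by case: (odd m).
Qed.

(** If l did not divide x, then (y / x)^2 = - p^m modulo l. *)
Lemma legendre_aniso p l m t delta x y : prime p -> prime l -> l <> p ->
  ~~ (l %| delta)%N -> legendre (- p%:Z ^+ m) l = -1 ->
  (l %| delta * p ^ (t + m) * (x * x) + delta * p ^ t * (y * y))%N ->
  (l %| x)%N && (l %| y)%N.
Proof.
move=> pr_p pr_l npl nld leg.
have -> : (delta * p ^ (t + m) * (x * x) + delta * p ^ t * (y * y) =
           delta * p ^ t * (p ^ m * (x * x) + y * y))%N by rewrite expnD; ring.
rewrite !Euclid_dvdM // (negPf nld) /= => /orP[].
  by rewrite Euclid_dvdX // dvdn_prime2 // => /andP[/eqP].
rewrite -!(Fp_nat_eq0 _ pr_l) natrD !natrM natrX => /eqP xy0.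
have x0 : x%:R = 0 :> 'F_l.
  apply/eqP; apply: contraTT isT => x0; move: leg; rewrite /legendre.
  case: ifP => // _; case: existsP => // -[]; exists (y%:R / x%:R).
  move/eqP: xy0; rewrite addrC addr_eq0 -!expr2 => /eqP yE.
  by rewrite rmorphN rmorphXn /= expr_div_n yE mulNr mulfK // expf_neq0.
by move/eqP: xy0; rewrite x0 eqxx !mulr0 add0r mulf_eq0 orbb.
Qed.

Lemma Fp_neg1_neq0 l : prime l -> (-1)%:~R != 0 :> 'F_l.
Proof. by move=> pr_l; rewrite mulrN1z oppr_eq0 oner_eq0. Qed.

(** With h = (p-1)/2, reciprocity gives (l/p) = (-1/l)^h (p/l), and
    (-p/l) = (-1/l) (p/l). *)
Lemma legendre_neg_prime p l : prime p -> odd p -> prime l -> odd l -> l <> p ->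
  legendre (- p%:Z) l = legendre (-1) l ^+ (p./2 + 1) * legendre l p.
Proof.
move=> pr_p odd_p pr_l odd_l npl.
have npl' : p != l by rewrite eq_sym; apply/eqP.
have := quadratic_reciprocity pr_p odd_p pr_l odd_l npl'.
have -> : quadratic_character (-1 : 'F_p) = (-1) ^+ p./2.
  apply: (sign_intr_inj (Fp_two_neq0 pr_p odd_p)); first exact: quadratic_character_sign.
    by rewrite -signr_odd; case: odd.
  by rewrite euler_criterion_Fp // rmorph_sign.
have legM (a b : int) : legendre (a * b) l = legendre a l * legendre b l.
  by rewrite /legendre rmorphM; apply: quadratic_characterM.
have legX j : legendre ((-1) ^+ j) l = legendre (-1) l ^+ j.
  elim: j => [|j IHj]; last by rewrite !exprS legM IHj.
  by rewrite !expr0 legendre1.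
move=> leg_lp; have -> : legendre l p = legendre ((-1) ^+ p./2 * p%:Z) l := esym leg_lp.
have lamh2 : (legendre (-1) l ^+ p./2) ^+ 2 = 1.
  by rewrite exprAC legendre_unit ?Fp_neg1_neq0 // expr1n.
rewrite -[- p%:Z]mulN1r !legM legX exprD expr1.
rewrite -[LHS]mul1r -[X in X * _ = _]lamh2.
by ring.
Qed.

(** The arithmetic condition of the vanishing criterion, for the weight
    e (p^m + 1) / 2 = e (h g + 1) with p = 2 h + 1.  Modulo p one has
    l^h = (l/p), so that l^(w-1) = l^(e-1) (l/p)^(g e), and it remains to see that
    (-1/l)^(h g + 1) (l/p)^(g e) = -1.  As e is odd and g has the parity of m, the
    left side is (-1/l) for even m and (-1/l)^(h+1) (l/p) = (-p/l) for odd m. *)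
Lemma character_condition p l m h g e : prime p -> odd p -> prime l -> l <> p ->
  h = p./2 -> (p ^ m = 1 + 2 * (h * g))%N -> odd g = odd m -> odd e ->
  legendre (- p%:Z ^+ m) l = -1 ->
  (l%:Z ^+ e.-1 + legendre (-1) l ^+ (h * g + 1) * l%:Z ^+ (e * (h * g + 1)).-1)%:~R
    = 0 :> 'F_p.
Proof.
move=> pr_p odd_p pr_l npl hE pmE odd_g odd_e leg.
have odd_l := legendre_odd pr_l leg.
have -> : ((e * (h * g + 1)).-1 = e.-1 + h * (g * e))%N by case: e odd_e => // e _; lia.
have lam2 := legendre_unit (Fp_neg1_neq0 pr_l).
set lam := legendre (-1) l in lam2 *.
have l0 : l%:Z%:~R != 0 :> 'F_p.
  by rewrite -pmulrn Fp_nat_eq0 // dvdn_prime2 //; apply/eqP => /esym.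
have eta2 := legendre_unit l0.
have lh : l%:Z%:~R ^+ h = (legendre l p)%:~R :> 'F_p.
  by rewrite hE -euler_criterion_Fp.
suff key : lam ^+ (h * g + 1) * legendre l p ^+ (g * e) = -1.
  have lX j : (l%:Z ^+ j)%:~R = l%:Z%:~R ^+ j :> 'F_p by rewrite rmorphXn.
  have etaX : ((legendre l p)%:~R : 'F_p) ^+ (g * e) = (legendre l p ^+ (g * e))%:~R.
    by rewrite rmorphXn.
  rewrite intrD intrM !lX [_%:~R ^+ (_ + _)]exprD [_ ^+ (h * _)]exprM.
  rewrite lh etaX mulrCA -intrM key.
  by rewrite mulrN1z mulrN mulr1 subrr.
move: leg; rewrite legendre_neg_exp // (sign_expr_odd _ eta2) oddM odd_e andbT odd_g.
rewrite (sign_expr_odd _ lam2) oddD oddM odd_g /=; case: (odd m) => /=; last first.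
  by rewrite andbF -/lam => ->.
rewrite legendre_neg_prime // -hE -/lam (sign_expr_odd _ lam2) oddD andbT.
by rewrite expr1.
Qed.

Lemma prime_pow_decomp p h m : p = (1 + 2 * h)%N ->
  exists2 g, (p ^ m = 1 + 2 * (h * g))%N & odd g = odd m.
Proof.
move=> pE; elim: m => [|m [g IHm odd_g]]; first by exists 0%N; rewrite ?muln0.
exists (1 + p * g)%N; first by rewrite expnS IHm pE; lia.
by rewrite oddD oddM odd_g pE oddD mul2n odd_double.
Qed.

(** This rules out l = 3 when p = 2 modulo 3. *)
Lemma legendre_neg1_mod3 p : (p %% 3 = 2)%N -> legendre (- p%:Z) 3 = 1.
Proof.
move=> pE; have pN1 : p%:R = -1 :> 'F_3.
  by rewrite -Fp_nat_mod // pE; apply: val_inj.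
rewrite /legendre rmorphN /= -pmulrn pN1 opprK oner_eq0.
case: existsP => // -[].
by exists 1; rewrite expr1n.
Qed.

(** * Finite forms of the identities of Euler and Jacobi *)

Lemma bin2D a b : 'C(a + b, 2) = ('C(a, 2) + 'C(b, 2) + a * b)%N.
Proof.
elim: a => [|a IHa]; first by rewrite addn0.
by rewrite addSn !binS !bin1 IHa; lia.
Qed.

Section FiniteIdentities.

Variables (R : comNzRingType) (q : R).

Definition qfact (n : nat) : R := \prod_(1 <= i < n.+1) (1 - q ^+ i).

Lemma qfact0 : qfact 0 = 1.
Proof. by rewrite /qfact big_geq. Qed.

Lemma qfactS n : qfact n.+1 = qfact n * (1 - q ^+ n.+1).
Proof. by rewrite /qfact big_nat_recr. Qed.

Definition shanks_term (n s : nat) : R :=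
  (-1) ^+ s * (\prod_(s.+1 <= i < n.+1) (1 - q ^+ i)) * q ^+ (s * n + 'C(s.+1, 2)).

(** Shanks's finite form of the pentagonal number theorem: as n grows, the left
    side tends to its term of index s = 0, which is the Euler product. *)
Lemma shanks_identity n :
  \sum_(0 <= s < n.+1) shanks_term n s =
  1 + \sum_(1 <= k < n.+1)
        (-1) ^+ k * (q ^+ (k * k + 'C(k, 2)) + q ^+ (k * k + 'C(k.+1, 2))).
Proof.
elim: n => [|n IHn].
  by rewrite big_nat1 !big_geq // /shanks_term big_geq //= mulr1 mul1r addr0.
rewrite [in RHS]big_nat_recr //= addrA -IHn big_nat_recr //= {IHn}.
(* The factors q^s - 1 and q^(s + n + 1) of the difference of two terms give
   consecutive values of V, so that the sum telescopes. *)
pose V s := if s is s'.+1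
  then (-1) ^+ s * (\prod_(s <= i < n.+1) (1 - q ^+ i)) * q ^+ (s * n + 'C(s.+1, 2)) else 0.
have step s : (0 <= s < n.+1)%N ->
    shanks_term n.+1 s - shanks_term n s = V s.+1 - V s.
  move=> /andP[_ les]; rewrite /shanks_term big_nat_recr //=.
  set Q := \prod_(s.+1 <= i < n.+1) _.
  have -> : V s = (-1) ^+ s * ((1 - q ^+ s) * Q) * q ^+ (s * n + 'C(s.+1, 2)).
    rewrite /V; case: s @Q les => [|s] Q les; first by rewrite expr0 subrr mul0r mulr0 mul0r.
    by rewrite big_ltn // ltnW.
  rewrite (binS s.+1) bin1 mulSn mulnS !exprD !exprS; ring.
have : \sum_(0 <= s < n.+1) (shanks_term n.+1 s - shanks_term n s) = V n.+1.
  by rewrite (eq_big_nat _ _ step) telescope_sumr // subr0.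
rewrite sumrB => /(canRL (subrK _)) ->.
rewrite [_ + \sum_(0 <= i < n.+1) _]addrC -addrA; congr (_ + _).
rewrite /V /shanks_term !big_geq // !mulr1 mulrDr; congr (_ * q ^+ _ + _ * q ^+ _).
by rewrite (binS n.+1) bin1; lia.
Qed.

Fixpoint qbinom (n k : nat) : R :=
  match n, k with
  | _, 0 => 1
  | 0, _.+1 => 0
  | n'.+1, k'.+1 => qbinom n' k'.+1 + q ^+ (n' - k') * qbinom n' k'
  end.

Lemma qbinom0 n : qbinom n 0 = 1.
Proof. by case: n. Qed.

Lemma qbinom_small n k : (n < k)%N -> qbinom n k = 0.
Proof.
elim: n k => [|n IHn] [|k] //= ltnk.
by rewrite !IHn ?mulr0 ?addr0 // ltnW.
Qed.

Lemma qbinom_fact n k : (k <= n)%N ->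
  qbinom n k * qfact k * qfact (n - k) = qfact n.
Proof.
elim: n k => [|n IHn] [|k] lekn; rewrite ?qbinom0 ?subn0 ?qfact0 ?mul1r //.
rewrite /= mulrDl mulrDl subSS.
have [ltkn|] := ltnP k n; last first.
  move=> lenk; have -> : k = n by apply/eqP; rewrite eqn_leq -ltnS lekn lenk.
  rewrite qbinom_small // !mul0r add0r subnn expr0 mul1r qfactS.
  by rewrite -[in RHS](IHn n) // subnn; ring.
have -> : qbinom n k.+1 * qfact k.+1 * qfact (n - k) = qfact n * (1 - q ^+ (n - k)).
  by rewrite -(IHn k.+1 ltkn) -(subnSK ltkn) [qfact (n - k.+1).+1]qfactS mulrA.
have -> : q ^+ (n - k) * qbinom n k * qfact k.+1 * qfact (n - k) =
    q ^+ (n - k) * (1 - q ^+ k.+1) * qfact n.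
  by rewrite -(IHn k lekn) qfactS; ring.
have -> : qfact n.+1 = qfact n * (1 - q ^+ (n - k) * q ^+ k.+1).
  by rewrite qfactS -exprD addnS subnK.
by ring.
Qed.

Lemma qbinomial_theorem n (y z : R) :
  \prod_(0 <= i < n) (y - z * q ^+ i) =
  \sum_(0 <= k < n.+1) (-1) ^+ k * q ^+ 'C(k, 2) * qbinom n k * y ^+ (n - k) * z ^+ k.
Proof.
elim: n => [|n IHn]; first by rewrite big_geq // big_nat1 /= !mulr1.
pose b m k := (-1) ^+ k * q ^+ 'C(k, 2) * qbinom n k * y ^+ (m - k) * z ^+ k.
rewrite big_nat_recr // IHn /=.
transitivity (\sum_(0 <= k < n.+2) b n.+1 k - \sum_(0 <= k < n.+1) b n k * (z * q ^+ n)).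
  rewrite [\sum_(0 <= k < n.+2) _]big_nat_recr //= [b _ n.+1]/b (@qbinom_small n n.+1) //.
  rewrite mulr0 !mul0r addr0 mulrBr !mulr_suml; congr (_ - _).
  by apply: eq_big_nat => k /andP[_ lekn]; rewrite /b (@subSn k n) // exprS; ring.
rewrite [\sum_(0 <= k < n.+2) b _ _]big_nat_recl // [RHS]big_nat_recl // /b !qbinom0.
rewrite -addrA; congr (_ + _).
rewrite -sumrB; apply: eq_big_nat => k /andP[_ lekn].
rewrite /= subSS (binS k) bin1 exprD.
have -> : q ^+ n = q ^+ (n - k) * q ^+ k by rewrite -exprD subnK.
by rewrite !exprS; ring.
Qed.

Lemma prod_exp_sub_low n :
  \prod_(0 <= i < n) (q ^+ n - q ^+ i) = (-1) ^+ n * q ^+ 'C(n, 2) * qfact n.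
Proof.
transitivity (\prod_(0 <= i < n) ((-1) * q ^+ i * (1 - q ^+ (n - i)))).
  apply: eq_big_nat => i /andP[_ lt_in].
  by rewrite -{1}(subnK (ltnW lt_in)) exprD; ring.
rewrite !big_split /= prodrXr -(bin2_sum n); congr (_ * _ * _).
  by rewrite prodr_const_nat subn0.
rewrite big_nat_rev add0n /qfact big_add1 /=.
by apply: eq_big_nat => i /andP[_ lt_in]; rewrite subKn.
Qed.

Lemma prod_exp_sub_high n :
  \prod_(n.+1 <= i < n.*2.+1) (q ^+ n - q ^+ i) = q ^+ (n * n) * qfact n.
Proof.
rewrite -addnn -addSn -{1}[n.+1]add0n big_addn addSnnS addnK /qfact.
rewrite [in RHS]big_add1 /= exprM -[X in (_ ^+ X) * _](subn0 n) -prodr_const_nat.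
rewrite -big_split /=; apply: eq_bigr => i _.
by rewrite addnC addSn -addnS exprD; ring.
Qed.

End FiniteIdentities.

Lemma rmorph_qbinom (R S : comNzRingType) (f : {rmorphism R -> S}) (q : R) n k :
  f (qbinom q n k) = qbinom (f q) n k.
Proof.
elim: n k => [|n IHn] [|k] //=; rewrite ?rmorph0 ?rmorph1 //.
by rewrite rmorphD rmorphM rmorphXn !IHn.
Qed.

(** The derivative at z = 1 of the q-binomial expansion of
    prod_(i <= 2 n) (q^n - z q^i): only the factor i = n vanishes there, and the
    other factors give qfact q n twice. *)
Lemma qfact_sqr (R : comNzRingType) (q : R) n :
  \sum_(0 <= k < n.*2.+2)
    (-1) ^+ k * q ^+ ('C(k, 2) + n * (n.*2.+1 - k)) * qbinom q n.*2.+1 k * k%:R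
  = (-1) ^+ n.+1 * q ^+ (n * n + 'C(n.+1, 2)) * qfact q n ^+ 2.
Proof.
pose G i : {poly R} := (q ^+ n)%:P - 'X * q%:P ^+ i.
pose F := \prod_(0 <= i < n.*2.+1) G i.
transitivity (F^`()).[1].
  rewrite /F /G qbinomial_theorem raddf_sum horner_sum; apply: eq_bigr => k _.
  rewrite -rmorph_qbinom -!polyC_exp -exprM -(rmorph_sign polyC) -!polyCM.
  rewrite mul_polyC /= derivZ derivXn hornerZ hornerMn hornerXn expr1n.
  by rewrite exprD mulrA; ring.
pose W := (\prod_(0 <= i < n) G i) * (q ^+ n)%:P * (\prod_(n.+1 <= i < n.*2.+1) G i).
rewrite (binS n) bin1.
have -> : F = W * (1 - 'X).
  rewrite /F (big_cat_nat _ (n := n)) //; last by rewrite -addnn -addnS leq_addr.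
  rewrite [\big[_/_]_(n <= i < _) _]big_ltn /=; last by rewrite ltnS -addnn leq_addr.
  have -> : G n = (q ^+ n)%:P * (1 - 'X) by rewrite /G -polyC_exp; ring.
  by rewrite /W; ring.
have G1 i : (G i).[1] = q ^+ n - q ^+ i by rewrite /G -polyC_exp !hornerE.
rewrite derivM derivB derivC derivX !hornerE /= subrr mulr0 add0r.
rewrite !horner_prod (eq_bigr _ (fun i _ => G1 i)).
rewrite [\prod_(n.+1 <= i < _) _](eq_bigr _ (fun i _ => G1 i)).
rewrite prod_exp_sub_low prod_exp_sub_high !exprD exprS.
by ring.
Qed.

#[local] Arguments qbinom : simpl never.

Lemma double_bin2 n : ('C(n, 2).*2 + n = n * n)%N.
Proof. by elim: n => // n IHn; rewrite binS bin1; lia. Qed.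

(** The indices k = n + 1 + j and k = n - j carry the same power of q up to a
    common factor, and opposite signs. *)
Lemma qfact_sqr_paired (R : comNzRingType) (q : R) n : GRing.lreg q ->
  qfact q n ^+ 2 =
  \sum_(0 <= j < n.+1) (-1) ^+ j * q ^+ 'C(j.+1, 2) *
     (qbinom q n.*2.+1 (n.+1 + j) * (n.+1 + j)%:R
       - qbinom q n.*2.+1 (n - j) * (n - j)%:R).
Proof.
move=> reg_q.
have reg_sE : GRing.lreg ((-1) ^+ n.+1 * q ^+ (n * n + 'C(n.+1, 2))).
  by apply: lregM; [apply: lreg_sign | apply: lregX].
apply: reg_sE; rewrite -qfact_sqr.
rewrite (big_cat_nat (n := n.+1)) //; last by rewrite ltnS -addnn -addnS leq_addr.
rewrite /= big_nat_rev add0n -[X in _ + \sum_(X <= i < _) _]add0n big_addn.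
have -> : (n.*2.+2 - n.+1 = n.+1)%N by lia.
rewrite -big_split mulr_sumr; apply: eq_big_nat => j /andP[_]; rewrite ltnS => le_jn.
rewrite /= subSS [(j + _)%N]addnC.
have -> : ('C(n - j, 2) + n * (n.*2.+1 - (n - j)) = n * n + 'C(n.+1, 2) + 'C(j.+1, 2))%N.
  have := bin2D (n - j) j; have := double_bin2 j; rewrite subnK // !binS !bin1.
  have [d ->] : exists d, n = (d + j)%N by exists (n - j)%N; rewrite subnK.
  have -> : ((d + j).*2.+1 - (d + j - j) = d + j.*2.+1)%N by lia.
  by rewrite addnK; nia.
have -> : ('C(n.+1 + j, 2) + n * (n.*2.+1 - (n.+1 + j)) = n * n + 'C(n.+1, 2) + 'C(j.+1, 2))%N.
  have -> : (n.*2.+1 - (n.+1 + j) = n - j)%N by lia.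
  have [d ->] : exists d, n = (d + j)%N by exists (n - j)%N; rewrite subnK.
  by rewrite bin2D !binS !bin1 addnK; nia.
have -> : (-1) ^+ (n - j) = - ((-1) ^+ n.+1 * (-1) ^+ j) :> R.
  rewrite -[n in n.+1](subnK le_jn) exprS exprD.
  rewrite -[LHS]mulr1 -[X in _ * X](sqrr_sign _ j).
  by move: ((-1) ^+ (n - j)) ((-1) ^+ j) => a b; ring.
by rewrite !exprD; ring.
Qed.

(** * Truncated power series *)

Definition eq_upto (R : comNzRingType) (N : nat) (f g : {poly R}) :=
  forall i, (i <= N)%N -> f`_i = g`_i.

Section Truncation.

Variables (R : comNzRingType) (N : nat).
Implicit Types f g h : {poly R}.

Lemma eq_upto_trans f g h : eq_upto N f g -> eq_upto N g h -> eq_upto N f h.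
Proof. by move=> fg gh i leiN; rewrite fg ?gh. Qed.

Lemma eq_upto_sym f g : eq_upto N f g -> eq_upto N g f.
Proof. by move=> fg i leiN; rewrite fg. Qed.

Lemma eq_uptoM f f' g g' : eq_upto N f f' -> eq_upto N g g' ->
  eq_upto N (f * g) (f' * g').
Proof.
move=> ff gg i leiN; rewrite !coefM; apply: eq_bigr => j _.
by rewrite ff ?gg // (leq_trans _ leiN) ?leq_subr // -ltnS.
Qed.

Lemma eq_uptoX f g n : eq_upto N f g -> eq_upto N (f ^+ n) (g ^+ n).
Proof. by move=> fg; elim: n => [|n IHn] //; rewrite !exprS; apply: eq_uptoM. Qed.

Lemma eq_uptoD f f' g g' : eq_upto N f f' -> eq_upto N g g' ->
  eq_upto N (f + g) (f' + g').
Proof. by move=> ff gg i leiN; rewrite !coefD ff ?gg. Qed.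

Lemma eq_uptoB f f' g g' : eq_upto N f f' -> eq_upto N g g' ->
  eq_upto N (f - g) (f' - g').
Proof. by move=> ff gg i leiN; rewrite !coefB ff ?gg. Qed.

Lemma eq_upto_sum (a b : nat) (F G : nat -> {poly R}) :
  (forall i, (a <= i < b)%N -> eq_upto N (F i) (G i)) ->
  eq_upto N (\sum_(a <= i < b) F i) (\sum_(a <= i < b) G i).
Proof.
move=> FG i leiN; rewrite !coef_sum.
by apply: eq_big_nat => j /FG ->.
Qed.

Lemma eq_upto_sum0 (a b : nat) (F : nat -> {poly R}) :
  (forall i, (a <= i < b)%N -> eq_upto N (F i) 0) ->
  eq_upto N (\sum_(a <= i < b) F i) 0.
Proof. by move/eq_upto_sum => F0 i leiN; rewrite F0 // big1. Qed.

Lemma eq_upto_XnM n f : (N < n)%N -> eq_upto N ('X^n * f) 0.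
Proof. by move=> ltNn i leiN; rewrite coefXnM coef0 (leq_ltn_trans leiN). Qed.

(** A series with constant term 1 is invertible. *)
Lemma eq_upto_cancel f g h : f`_0 = 1 ->
  eq_upto N (f * g) (f * h) -> eq_upto N g h.
Proof.
move=> f0 eqfgh; elim/ltn_ind=> i IHi leiN.
have := eqfgh i leiN; rewrite !coefM !big_ord_recl f0 !mul1r subn0.
rewrite [X in _ + X](eq_bigr (fun j => f`_(lift ord0 j) * h`_(i - lift ord0 j))).
  exact: addIr.
move=> j _; congr (_ * _); rewrite lift0 /=; apply: IHi.
  by have := ltn_ord j; lia.
by apply: leq_trans leiN; apply: leq_subr.
Qed.

End Truncation.

(** * The theta series of the Euler product and of its cube *)

Local Notation P := (qfact ('X : {poly int})).

Lemma qfact_stable N n : (N <= n)%N -> eq_upto N (P n) (P N).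
Proof.
move=> leNn i leiN; rewrite (@euler_product_stable i n) ?(leq_trans leiN) //.
by rewrite (@euler_product_stable i N).
Qed.

Lemma qfact_coef0 N : (P N)`_0 = 1.
Proof. by rewrite (@euler_product_stable 0 N) // /euler_product big_geq // coef1. Qed.

(** The q-binomial coefficient is P_n / (P_k P_(n-k)), where the three factors
    agree with P_N up to q^N. *)
Lemma qbinom_limit N n k : (N <= k)%N -> (N + k <= n)%N ->
  eq_upto N (P N * qbinom 'X n k) 1.
Proof.
move=> leNk leNkn.
have lekn : (k <= n)%N by apply: leq_trans leNkn; apply: leq_addl.
apply: (eq_upto_cancel (qfact_coef0 N)); rewrite mulr1.
have PnN : eq_upto N (P n) (P N).
  by apply: qfact_stable; apply: leq_trans lekn.
apply: eq_upto_trans PnN; apply: eq_upto_sym; rewrite -(qbinom_fact 'X lekn).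
rewrite [P N * (P N * _)]mulrA [P N * P N * _]mulrC mulrA.
have leNnk : (N <= n - k)%N by rewrite leq_subRL // addnC.
by apply: eq_uptoM (qfact_stable leNnk); apply: eq_uptoM (qfact_stable leNk).
Qed.

(** The two q-binomial coefficients paired with j become 1 / P_N, and the
    difference of their weights n + 1 + j and n - j is 2 j + 1. *)
Lemma jacobi_cube N :
  eq_upto N (P N ^+ 3)
    (\sum_(0 <= j < N.+1) (-1) ^+ j * 'X^('C(j.+1, 2)) * j.*2.+1%:R).
Proof.
have regX : GRing.lreg ('X : {poly int}) by apply/lregP; rewrite polyX_eq0.
(* With n = 2 N the indices n + 1 + j and n - j, for j <= N, are at distance at
   least N from both ends of the row 2 n + 1. *)
have PE : eq_upto N (P N ^+ 3) (P N * P N.*2 ^+ 2).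
  rewrite exprS; apply: eq_uptoM => //; apply: eq_uptoX; apply: eq_upto_sym.
  by apply: qfact_stable; rewrite -addnn leq_addr.
apply: eq_upto_trans PE _; rewrite qfact_sqr_paired // mulr_sumr.
rewrite (big_cat_nat (n := N.+1)) //=; last by rewrite ltnS -addnn leq_addr.
rewrite -[X in eq_upto _ _ X]addr0; apply: eq_uptoD; last first.
  apply: eq_upto_sum0 => j /andP[lt_Nj _].
  rewrite mulrCA -[(-1) ^+ j * _]mulrC -!mulrA; apply: eq_upto_XnM.
  by rewrite binS bin1; lia.
apply: eq_upto_sum => j /andP[_]; rewrite ltnS => le_jN.
have -> : P N * ((-1) ^+ j * 'X^('C(j.+1, 2)) *
    (qbinom 'X N.*2.*2.+1 (N.*2.+1 + j) * (N.*2.+1 + j)%:R -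
     qbinom 'X N.*2.*2.+1 (N.*2 - j) * (N.*2 - j)%:R)) =
  (-1) ^+ j * 'X^('C(j.+1, 2)) *
    (P N * qbinom 'X N.*2.*2.+1 (N.*2.+1 + j) * (N.*2.+1 + j)%:R -
     P N * qbinom 'X N.*2.*2.+1 (N.*2 - j) * (N.*2 - j)%:R) by ring.
have -> : j.*2.+1%:R = 1 * (N.*2.+1 + j)%:R - 1 * (N.*2 - j)%:R :> {poly int}.
  have -> : (N.*2.+1 + j = j.*2.+1 + (N.*2 - j))%N by lia.
  by rewrite !mul1r natrD addrK.
apply: eq_uptoM => //.
by apply: eq_uptoB; (apply: eq_uptoM => //; apply: qbinom_limit); lia.
Qed.

(** In Shanks's sum the terms with s >= 1 have order s N + s (s + 1) / 2 > N. *)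
Lemma euler_pentagonal N :
  eq_upto N (P N)
    (1 + \sum_(1 <= k < N.+1)
           (-1) ^+ k * ('X^(k * k + 'C(k, 2)) + 'X^(k * k + 'C(k.+1, 2)))).
Proof.
rewrite -shanks_identity big_ltn // -[X in eq_upto _ X]addr0; apply: eq_uptoD.
  by rewrite /shanks_term mul1r mulr1.
apply: eq_upto_sym; apply: eq_upto_sum0 => s /andP[s0 _].
rewrite /shanks_term mulrC; apply: eq_upto_XnM.
by rewrite binS bin1; nia.
Qed.

Definition theta_index (c x : nat) : nat := (x * x).-1 %/ c.
#[local] Arguments theta_index : simpl never.

Definition theta_poly (c : nat) (psi : nat -> int) (M : nat) : {poly int} :=
  \sum_(0 <= x < M) (psi x)%:P * 'X^(theta_index c x).

(** Where psi does not vanish, the division in theta_index is exact. *)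
Definition theta_support (c : nat) (psi : nat -> int) :=
  forall x, psi x != 0 -> exists k, (x * x = c * k + 1)%N.

Lemma theta_exponent c x k : (0 < c)%N -> (x * x = c * k + 1)%N -> theta_index c x = k.
Proof. by move=> c0 xE; rewrite /theta_index xE addn1 /= mulKn. Qed.

(** A term of index x > c N + 1 has order (x^2 - 1) / c > N. *)
Lemma theta_poly_stable c psi N M M' : (0 < c)%N -> theta_support c psi ->
  (c * N + 1 < M)%N -> (M <= M')%N ->
  eq_upto N (theta_poly c psi M') (theta_poly c psi M).
Proof.
move=> c0 supp ltNM leMM'; rewrite /theta_poly (big_cat_nat (n := M)) //=.
rewrite -[X in eq_upto _ _ X]addr0; apply: eq_uptoD => //.
apply: eq_upto_sum0 => x /andP[leMx _].
have [->|/supp[k xE]] := eqVneq (psi x) 0; first by rewrite mul0r.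
rewrite (theta_exponent c0 xE) mulrC; apply: eq_upto_XnM.
by rewrite ltnNge; apply/negP=> lekN; nia.
Qed.

(** The Dirichlet characters (-4/x) and (12/x). *)
Definition chi4 (x : nat) : int := nth 0 [:: 0; 1; 0; -1] (x %% 4).

Definition chi12 (x : nat) : int :=
  nth 0 [:: 0; 1; 0; 0; 0; -1; 0; -1; 0; 0; 0; 1] (x %% 12).

#[local] Arguments chi4 : simpl never.
#[local] Arguments chi12 : simpl never.

(** Reduces the multiplicativity of a character given by a table to a finite
    computation. *)
Lemma periodic_mul (s : seq int) (N x y : nat) : (0 < N)%N ->
  all (fun i => all (fun j => s`_((i * j) %% N) == s`_i * s`_j) (iota 0 N)) (iota 0 N) ->
  s`_((x * y) %% N) = s`_(x %% N) * s`_(y %% N).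
Proof.
move=> N0 /allP/(_ (x %% N)%N); rewrite mem_iota ltn_mod => /(_ N0)/allP/(_ (y %% N)%N).
by rewrite mem_iota ltn_mod => /(_ N0)/eqP <-; rewrite modnMm.
Qed.

Lemma chi4M x y : chi4 (x * y) = chi4 x * chi4 y.
Proof. by apply: periodic_mul => //; vm_compute. Qed.

Lemma chi12M x y : chi12 (x * y) = chi12 x * chi12 y.
Proof. by apply: periodic_mul => //; vm_compute. Qed.

Lemma chi4_odd j : chi4 j.*2.+1 = (-1) ^+ j.
Proof.
rewrite -signr_odd /chi4 -[j in LHS]odd_double_half.
have -> : ((odd j + j./2.*2).*2.+1 = j./2 * 4 + (odd j).*2.+1)%N by lia.
by rewrite modnMDl; case: (odd j).
Qed.

Lemma chi4_even j : chi4 j.*2 = 0.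
Proof.
rewrite /chi4 -[j in LHS]odd_double_half.
have -> : ((odd j + j./2.*2).*2 = j./2 * 4 + (odd j).*2)%N by lia.
by rewrite modnMDl; case: (odd j).
Qed.

Lemma chi12_mod6 j r : chi12 (6 * j + r) =
  chi12 (6 * (odd j) + r).
Proof.
rewrite /chi12 -[j in LHS]odd_double_half.
have -> : (6 * (odd j + j./2.*2) + r = j./2 * 12 + (6 * odd j + r))%N by lia.
by rewrite modnMDl.
Qed.

Lemma chi4_support : theta_support 8 (fun x => chi4 x * x%:R).
Proof.
move=> x; rewrite -[x]odd_double_half; case: (odd x); last first.
  by rewrite add0n chi4_even mul0r.
move=> _; exists 'C(x./2.+1, 2); have := double_bin2 x./2.+1; lia.
Qed.

(** Square roots of 1 modulo 24 are the integers prime to 6. *)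
Lemma chi12_support : theta_support 24 chi12.
Proof.
move=> x; rewrite /chi12 {2 3}(divn_eq x 12).
move: (x %/ 12)%N (ltn_pmod x (isT : 0 < 12)%N) => q.
move: (x %% 12)%N => r; do 12?[case: r => [|r] //=] => _ _.
- by exists (6 * q * q + q)%N; lia.
- by exists (6 * q * q + 5 * q + 1)%N; lia.
- by exists (6 * q * q + 7 * q + 2)%N; lia.
- by exists (6 * q * q + 11 * q + 5)%N; lia.
Qed.

(** The terms of even index vanish, and x = 2 j + 1 gives (x^2 - 1) / 8 =
    j (j + 1) / 2. *)
Lemma jacobi_theta n :
  \sum_(0 <= j < n.+1) (-1) ^+ j * 'X^('C(j.+1, 2)) * j.*2.+1%:R
  = theta_poly 8 (fun x => chi4 x * x%:R) n.*2.+2.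
Proof.
rewrite /theta_poly; elim: n => [|n IHn].
  rewrite big_nat1 big_nat_recl // big_nat1 mulr0 mulr1 polyC0 mul0r add0r.
  by rewrite -[chi4 1]/1 polyC1 expr0 !mulr1.
rewrite big_nat_recr // IHn doubleS [in RHS]big_nat_recr // big_nat_recr //=.
rewrite -/(n.+1.*2) chi4_even -[n.*2.+3]/(n.+1.*2.+1) chi4_odd mul0r polyC0 mul0r addr0.
congr (_ + _).
rewrite (@theta_exponent 8 _ 'C(n.+2, 2)) //; last by have := double_bin2 n.+2; lia.
by rewrite polyCM polyC_natr rmorph_sign; ring.
Qed.

(** The indices x = 6 k - 1 and x = 6 k + 1 give the pentagonal exponents
    (x^2 - 1) / 24 = k (3 k - 1) / 2 and k (3 k + 1) / 2. *)
Lemma pentagonal_theta n :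
  1 + \sum_(1 <= k < n.+1)
           (-1) ^+ k * ('X^(k * k + 'C(k, 2)) + 'X^(k * k + 'C(k.+1, 2)))
  = theta_poly 24 chi12 (6 * n + 2).
Proof.
rewrite /theta_poly; elim: n => [|n IHn].
  rewrite big_geq // addr0 big_nat_recl // big_nat1.
  by rewrite -[chi12 0]/0 -[chi12 1]/1 polyC0 polyC1 mul0r add0r mul1r.
rewrite big_nat_recr // addrA IHn.
have -> : (6 * n.+1 + 2 = (6 * n + 2).+4.+2)%N by lia.
rewrite !big_nat_recr //= -!addrA.
have chiE r b : (chi12 r = b 0%N) -> (chi12 (6 + r) = b 1%N) -> chi12 (6 * n + r) = b (odd n).
  by move=> b0 b1; rewrite chi12_mod6; case: (odd n).
rewrite -!addnS (chiE 2 (fun=> 0)) // (chiE 3 (fun=> 0)) // (chiE 4 (fun=> 0)) //.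
rewrite (chiE 6 (fun=> 0)) // (chiE 5 (fun b => (-1) ^+ b.+1)) //.
rewrite (chiE 7 (fun b => (-1) ^+ b.+1)) //.
have -> : ((-1) ^+ (odd n).+1)%:P = (-1) ^+ n.+1 :> {poly int}.
  by rewrite exprS signr_odd -exprS rmorph_sign.
rewrite !polyC0 !mul0r !add0r mulrDr.
congr (_ + (_ * 'X^_ + _ * 'X^_)).
  by rewrite (@theta_exponent 24 _ (n.+1 * n.+1 + 'C(n.+1, 2))) //;
    have := double_bin2 n.+1; nia.
rewrite (@theta_exponent 24 _ (n.+1 * n.+1 + 'C(n.+2, 2))) //.
by have := double_bin2 n.+2; nia.
Qed.

Lemma theta_euler_cube N M : (8 * N + 1 < M)%N ->
  eq_upto N (P N ^+ 3) (theta_poly 8 (fun x => chi4 x * x%:R) M).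
Proof.
move=> ltNM; have leN4 : (N <= 4 * N)%N by lia.
(* The partial sum up to 4 N has index bound 2 (4 N) + 2 > 8 N + 1. *)
have step : eq_upto N (P N ^+ 3)
    (theta_poly 8 (fun x => chi4 x * x%:R) (4 * N).*2.+2).
  apply: (@eq_upto_trans _ _ _ (P (4 * N) ^+ 3)).
    exact/eq_uptoX/eq_upto_sym/qfact_stable.
  by rewrite -jacobi_theta => i leiN; apply: jacobi_cube; apply: leq_trans leN4.
apply: eq_upto_trans step _; have [leM|/ltnW leM] := leqP M (4 * N).*2.+2.
  exact: theta_poly_stable chi4_support ltNM leM.
by apply/eq_upto_sym/theta_poly_stable => //; [apply: chi4_support | lia].
Qed.

Lemma theta_euler N M : (24 * N + 1 < M)%N ->
  eq_upto N (P N) (theta_poly 24 chi12 M).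
Proof.
move=> ltNM; have leN4 : (N <= 4 * N)%N by lia.
(* The partial sum up to 4 N has index bound 6 (4 N) + 2 > 24 N + 1. *)
have step : eq_upto N (P N) (theta_poly 24 chi12 (6 * (4 * N) + 2)).
  apply: (@eq_upto_trans _ _ _ (P (4 * N))); first exact/eq_upto_sym/qfact_stable.
  by rewrite -pentagonal_theta => i leiN; apply: euler_pentagonal; apply: leq_trans leN4.
apply: eq_upto_trans step _; have [leM|/ltnW leM] := leqP M (6 * (4 * N) + 2).
  exact: theta_poly_stable chi12_support ltNM leM.
by apply/eq_upto_sym/theta_poly_stable => //; [apply: chi12_support | lia].
Qed.

(** * The coefficients of a power of D modulo p *)

Definition truncates (N : nat) (f : fps int) (g : {poly int}) :=
  forall i, (i <= N)%N -> f i = g`_i.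

Section Truncates.

Variable N : nat.
Implicit Types (f : fps int) (g h : {poly int}).

Lemma truncates_exp f g n : truncates N f g -> truncates N (fps_exp f n) (g ^+ n).
Proof.
move=> fg; elim: n => [|n IHn] i leiN; first by rewrite coef1.
rewrite exprS coefM [LHS]/(fps_mul f (fps_exp f n) i).
apply: eq_bigr => j _; rewrite fg ?IHn // (leq_trans _ leiN) ?leq_subr //.
by rewrite -ltnS.
Qed.

Lemma truncates_mulq f g : truncates N f g -> truncates N (fps_mulq f) ('X * g).
Proof. by move=> fg [|i] leiN; rewrite coefXM //= fg // ltnW. Qed.

Lemma truncates_subst f g d : (0 < d)%N -> truncates N f g ->
  truncates N (fps_subst d f) (g \Po 'X^d).
Proof.
move=> d0 fg i leiN; rewrite coef_comp_poly_Xn // /fps_subst; case: ifP => // _.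
by rewrite fg // (leq_trans _ leiN) // leq_div.
Qed.

Lemma truncates_trans f g h : truncates N f g -> eq_upto N g h -> truncates N f h.
Proof. by move=> fg gh i leiN; rewrite fg ?gh. Qed.

Lemma truncates_euler : truncates N euler_product (P N).
Proof. by move=> i leiN; rewrite -(@euler_product_stable i N). Qed.

End Truncates.

Lemma eq_upto_comp_Xn (R : comNzRingType) N d (f g : {poly R}) : (0 < d)%N ->
  eq_upto N f g -> eq_upto N (f \Po 'X^d) (g \Po 'X^d).
Proof.
move=> d0 fg i leiN; rewrite !coef_comp_poly_Xn //; case: ifP => // _.
by rewrite fg // (leq_trans _ leiN) // leq_div.
Qed.

Lemma truncates_D_exp N delta k a e g : (0 < delta)%N ->
  (k * (24 %/ delta) = e * a)%N -> eq_upto N (P N ^+ e) g ->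
  truncates N (fps_exp (D delta) k) ('X^k * (g \Po 'X^delta) ^+ a).
Proof.
move=> delta0 kE Pg.
have : truncates N (fps_exp (D delta) k)
    (('X * (P N \Po 'X^delta) ^+ (24 %/ delta)) ^+ k).
  apply/truncates_exp/truncates_mulq/truncates_exp/truncates_subst => //.
  exact: truncates_euler.
move/truncates_trans; apply; rewrite exprMn -exprM mulnC kE exprM.
apply: eq_uptoM => //; apply: eq_uptoX.
have -> : (P N \Po 'X^delta) ^+ e = (P N ^+ e) \Po 'X^delta by rewrite rmorphXn.
exact: eq_upto_comp_Xn.
Qed.

Lemma Fp_poly_frobenius p (f : {poly 'F_p}) j : prime p ->
  f ^+ (p ^ j) = f \Po 'X^(p ^ j).
Proof.
move=> pr_p; have charp : p \in [pchar {poly 'F_p}] by rewrite pchar_poly pchar_Fp.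
have frob (g : {poly 'F_p}) : g ^+ p = g \Po 'X^p.
  rewrite -(pFrobenius_autE charp) -[g in LHS]coefK poly_def rmorph_sum /=.
  rewrite comp_polyE; apply: eq_bigr => i _.
  rewrite pFrobenius_autE exprZn -[X in _ ^+ X *: _](card_Fp pr_p) expf_card.
  by rewrite -!exprM mulnC.
elim: j => [|j IHj]; first by rewrite expn0 !expr1 comp_polyXr.
by rewrite expnSr exprM IHj frob -comp_polyA comp_Xn_poly -exprM mulnC.
Qed.

(** For a large bound M, the sum of psi(x) psi(y) over all representations of n by
    A x^2 + B y^2. *)
Definition represented_sum (psi : nat -> int) (A B M n : nat) : int :=
  \sum_(0 <= x < M) \sum_(0 <= y < M)
    if (A * (x * x) + B * (y * y) == n)%N then psi x * psi y else 0.

(** The hypothesis on c * k absorbs the shift by q^k: it turns the exponent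
    k + A (x^2 - 1) / c + B (y^2 - 1) / c into (A x^2 + B y^2) / c. *)
Lemma D_exp_mod_coef p delta k m t c e psi n M : prime p ->
  (0 < delta)%N -> (0 < c)%N ->
  (k * (24 %/ delta) = e * (p ^ t * (p ^ m + 1)))%N ->
  (c * k = delta * p ^ (t + m) + delta * p ^ t)%N ->
  theta_support c psi -> eq_upto n (P n ^+ e) (theta_poly c psi M) ->
  fps_mod p (fps_exp (D delta) k) n =
  (represented_sum psi (delta * p ^ (t + m)) (delta * p ^ t) M (c * n))%:~R.
Proof.
move=> pr_p delta0 c0 kE ckE supp Ptheta.
pose a j := (delta * p ^ j)%N.
rewrite /fps_mod (truncates_D_exp delta0 kE Ptheta (leqnn n)).
rewrite -coef_map rmorphM rmorphXn /= map_polyX rmorphXn /= map_comp_poly map_polyXn.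
set T := map_poly _ (theta_poly c psi M).
have TE j : (T \Po 'X^delta) ^+ (p ^ j) =
    \sum_(0 <= x < M) (psi x)%:~R%:P * 'X^(a j * theta_index c x).
  rewrite Fp_poly_frobenius // -comp_polyA comp_Xn_poly -exprM mulnC -/(a j).
  rewrite /T rmorph_sum raddf_sum; apply: eq_bigr => x _.
  rewrite /= rmorphM /= map_polyC map_polyXn /= comp_polyM comp_polyC comp_Xn_poly.
  by rewrite -exprM.
rewrite mulnDr muln1 -expnD exprD !TE mulr_suml mulr_sumr coef_sum rmorph_sum.
apply: eq_bigr => x _; rewrite mulr_sumr mulr_sumr coef_sum rmorph_sum.
apply: eq_bigr => y _.
set i := theta_index c x; set j := theta_index c y.
have -> : 'X^k * ((psi x)%:~R%:P * 'X^(a (t + m)%N * i) *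
                  ((psi y)%:~R%:P * 'X^(a t * j))) =
    ((psi x)%:~R * (psi y)%:~R)%:P * 'X^(k + (a (t + m)%N * i + a t * j)) :> {poly 'F_p}.
  by rewrite polyCM !exprD; ring.
rewrite coefCM coefXn {}/i {}/j /=.
have [->|/supp[i xE]] := eqVneq (psi x) 0; first by rewrite !mul0r if_same.
have [->|/supp[j yE]] := eqVneq (psi y) 0; first by rewrite !mulr0 mul0r if_same.
rewrite (theta_exponent c0 xE) (theta_exponent c0 yE) -!/(a _) -intrM.
have -> : (a (t + m)%N * (x * x) + a t * (y * y) =
           c * (k + (a (t + m)%N * i + a t * j)))%N.
  by rewrite [in RHS]mulnDr ckE xE yE -!/(a _); ring.
by rewrite eqn_pmul2l // [n == _]eq_sym; case: eqP; rewrite ?mulr1 ?mulr0.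
Qed.

(** * Hecke operators *)

Lemma sum_multiples (R : zmodType) (l M : nat) (F : nat -> R) : (0 < l)%N ->
  (forall x, ~~ (l %| x)%N -> F x = 0) ->
  \sum_(0 <= x < l * M) F x = \sum_(0 <= x < M) F (l * x)%N.
Proof.
move=> l0 F0; elim: M => [|M IHM]; first by rewrite muln0 !big_geq.
rewrite big_nat_recr //= -IHM (big_cat_nat (n := (l * M)%N)) //=; last first.
  by rewrite leq_pmul2l.
congr (_ + _); rewrite mulnS addnC big_ltn; last by rewrite -addn1 leq_add2l.
rewrite big_nat big1 ?addr0 // => x /andP[ltx xlt]; apply: F0.
apply/negP=> /dvdnP[d xE]; move: ltx xlt; rewrite xE -mulnSr !(mulnC l) !ltn_pmul2r //.
by rewrite ltnS leqNgt => /negP.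
Qed.

Section Descent.

Variables (psi : nat -> int) (A B c l : nat) (s : int).
Hypotheses (pr_l : prime l) (nlc : ~~ (l %| c)%N).
Hypothesis aniso : forall x y, (l %| A * (x * x) + B * (y * y))%N ->
  (l %| x)%N && (l %| y)%N.
Hypothesis psi_l : forall x y, psi (l * x)%N * psi (l * y)%N = s * (psi x * psi y).

Lemma represented_sum_ndvd M n : ~~ (l %| n)%N ->
  represented_sum psi A B M (c * (l * n)) = 0.
Proof.
move=> nln; rewrite /represented_sum big1 // => x _; rewrite big1 // => y _.
case: eqP => // repr; case/negP: nln.
have /aniso/andP[/dvdnP[x' xE] /dvdnP[y' yE]] : (l %| A * (x * x) + B * (y * y))%N.
  by rewrite repr dvdn_mull // dvdn_mulr.
have l0 := prime_gt0 pr_l.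
have : (l * (c * n) = l * (l * (A * (x' * x') + B * (y' * y'))))%N.
  rewrite -[in LHS]mulnCA -repr xE yE; ring.
move/eqP; rewrite eqn_pmul2l // => /eqP cnE.
by move: (dvdn_mulr (A * (x' * x') + B * (y' * y')) (dvdnn l));
  rewrite -cnE Euclid_dvdM // (negPf nlc).
Qed.

Lemma represented_sum_dvd M n :
  represented_sum psi A B (l * M) (c * (l * (l * n))) =
  s * represented_sum psi A B M (c * n).
Proof.
have l0 := prime_gt0 pr_l.
have van x y : ~~ ((l %| x)%N && (l %| y)%N) ->
    (if (A * (x * x) + B * (y * y) == c * (l * (l * n)))%N
     then psi x * psi y else 0) = 0.
  move=> nlxy; case: eqP => // repr; case/negP: nlxy; apply: aniso.
  by rewrite repr dvdn_mull // dvdn_mulr.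
rewrite /represented_sum (sum_multiples _ l0); last first.
  by move=> x nlx; rewrite big1 // => y _; apply: van; rewrite negb_and nlx.
rewrite mulr_sumr; apply: eq_bigr => x _.
rewrite (sum_multiples _ l0); last first.
  by move=> y nly; apply: van; rewrite negb_and nly orbT.
rewrite mulr_sumr; apply: eq_bigr => y _.
have -> : (A * (l * x * (l * x)) + B * (l * y * (l * y)) =
           l * (l * (A * (x * x) + B * (y * y))))%N by ring.
rewrite !(mulnCA c l) !eqn_pmul2l // psi_l.
by case: ifP; rewrite ?mulr0.
Qed.

End Descent.

(** The vanishing criterion: s = psi(l)^2 is the factor by which the coefficient of
    q^(n/l) is multiplied to give that of q^(l n). *)
Lemma D_hecke_vanish p delta k m t c e psi l s : prime p -> prime l ->
  (0 < delta)%N -> (0 < c)%N ->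
  (k * (24 %/ delta) = e * (p ^ t * (p ^ m + 1)))%N ->
  (c * k = delta * p ^ (t + m) + delta * p ^ t)%N ->
  theta_support c psi ->
  (forall N M, (c * N + 1 < M)%N -> eq_upto N (P N ^+ e) (theta_poly c psi M)) ->
  ~~ (l %| c)%N ->
  (forall x y, (l %| delta * p ^ (t + m) * (x * x) + delta * p ^ t * (y * y))%N ->
     (l %| x)%N && (l %| y)%N) ->
  (forall x y, psi (l * x)%N * psi (l * y)%N = s * (psi x * psi y)) ->
  (s + D_char delta k l * l%:Z ^+ (D_weight delta k).-1)%:~R = 0 :> 'F_p ->
  fps_mod p (D_hecke delta k l) =1 (fun=> 0).
Proof.
move=> pr_p pr_l delta0 c0 kE ckE supp Ptheta nlc aniso psi_l char_l n.
have coefE N M : (c * N + 1 < M)%N -> (fps_exp (D delta) k N)%:~R =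
    (represented_sum psi (delta * p ^ (t + m)) (delta * p ^ t) M (c * N))%:~R :> 'F_p.
  by move=> ltNM; rewrite -(D_exp_mod_coef pr_p delta0 c0 kE ckE supp (Ptheta _ _ ltNM)).
rewrite /fps_mod /D_hecke /hecke; case: ifP => [/dvdnP[d ->]|/negbT nln]; last first.
  rewrite mulr0 addr0 (coefE _ (c * (l * n) + 2)%N); last by rewrite ltn_add2l.
  by rewrite (represented_sum_ndvd psi pr_l nlc aniso).
have l0 := prime_gt0 pr_l; have l1 := prime_gt1 pr_l.
pose M := (l * (c * d) + 2)%N.
rewrite mulnK // [(d * l)%N]mulnC rmorphD rmorphM /=.
rewrite (coefE (l * (l * d))%N (l * M)%N); last by rewrite /M; nia.
rewrite (coefE d M); last by rewrite /M; nia.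
rewrite (represented_sum_dvd c pr_l aniso psi_l) rmorphM /= -mulrDl -intrD.
by rewrite char_l mul0r.
Qed.

Lemma chi12_prime_sqr l : prime l -> odd l -> l <> 3%N -> chi12 l ^+ 2 = 1.
Proof.
move=> pr_l odd_l l3.
have n3l : ~~ (3 %| l)%N by rewrite dvdn_prime2 // eq_sym; apply/eqP.
have lE := divn_eq l 12; have := ltn_pmod l (isT : 0 < 12)%N.
rewrite /chi12; move: (l %/ 12)%N (l %% 12)%N lE => q r lE.
by do 12?[case: r lE => [|r] lE //=] => _; exfalso; move: odd_l n3l; rewrite lE; lia.
Qed.

(** The criterion with its two theta series: e = 1 uses chi12, which vanishes at
    l = 3, and e = 3 uses chi4(x) x. *)
Lemma D_hecke_eq0 p delta k m t e l : prime p -> prime l -> l <> p ->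
  (delta %| 24)%N -> ~~ (l %| delta)%N -> (e = 1%N /\ l <> 3%N) \/ e = 3%N ->
  (24 * k = delta * (e * (p ^ t * (p ^ m + 1))))%N ->
  legendre (- p%:Z ^+ m) l = -1 ->
  (l%:Z ^+ e.-1 + D_char delta k l * l%:Z ^+ (D_weight delta k).-1)%:~R = 0 :> 'F_p ->
  fps_mod p (D_hecke delta k l) =1 (fun=> 0).
Proof.
move=> pr_p pr_l npl d24 nld eE k24E leg char_l.
have odd_l := legendre_odd pr_l leg.
have delta0 : (0 < delta)%N by apply: dvdn_gt0 d24.
have k24 : (24 * k = e * (delta * p ^ (t + m) + delta * p ^ t))%N.
  by rewrite k24E expnD; ring.
have kE : (k * (24 %/ delta) = e * (p ^ t * (p ^ m + 1)))%N.
  apply/eqP; rewrite -(eqn_pmul2l delta0) -k24E; apply/eqP.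
  by rewrite mulnCA [(delta * _)%N]mulnC divnK // mulnC.
have aniso x y := @legendre_aniso p l m t delta x y pr_p pr_l npl nld leg.
have n2l : ~~ (l %| 2)%N by rewrite dvdn_prime2 //; apply/eqP=> l2; rewrite l2 in odd_l.
case: eE => [[e1 l3]|e3].
  apply: (@D_hecke_vanish p delta k m t 24 e chi12 l 1) => //.
  - by rewrite k24 e1; exact: mul1n.
  - exact: chi12_support.
  - by move=> N M ltNM; rewrite e1 expr1; apply: theta_euler.
  - rewrite -[24%N]/(2 * (2 * (2 * 3)))%N !Euclid_dvdM // (negPf n2l) /=.
    by rewrite dvdn_prime2 //; apply/eqP.
  - by move=> x y; rewrite !chi12M mulrACA -expr2 chi12_prime_sqr.
  by move: char_l; rewrite e1.
apply: (@D_hecke_vanish p delta k m t 8 e (fun x => chi4 x * x%:R) l (l%:Z ^+ 2)) => //.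
- by move: k24; rewrite e3; lia.
- exact: chi4_support.
- by move=> N M ltNM; rewrite e3; apply: theta_euler_cube.
- by rewrite -[8%N]/(2 * (2 * 2))%N !Euclid_dvdM // (negPf n2l).
- move=> x y; rewrite !chi4M !natrM.
  have : chi4 l ^+ 2 = 1.
    by rewrite -[l]odd_double_half odd_l add1n chi4_odd sqrr_sign.
  move=> chi2; transitivity (chi4 l ^+ 2 * (l%:R ^+ 2 * (chi4 x * x%:R * (chi4 y * y%:R)))).
    by ring.
  by rewrite chi2 mul1r !natz.
by move: char_l; rewrite e3.
Qed.

(** * Weights and characters *)

Lemma kronecker_odd_prime a l : prime l -> odd l -> kronecker a l = legendre a l.
Proof.
move=> pr_l odd_l; rewrite /kronecker gtn_eqF ?prime_gt0 //.
rewrite prime_decompE primes_prime // big_seq1 /= logn_prime // eqxx expr1.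
by rewrite /kronecker_prime; case: eqP => // l2; rewrite l2 in odd_l.
Qed.

(** For delta <= 4 the number under the Kronecker symbol is a square up to the sign
    (-1)^(12/delta), and k and the weight have the same parity for delta = 4, while
    the weight is even for delta < 4. *)
Lemma D_char_weight delta k l : delta \in [:: 1; 2; 3; 4; 8; 24]%N ->
  prime l -> odd l -> ~~ (l %| delta)%N ->
  D_char delta k l = legendre (-1) l ^+ D_weight delta k.
Proof.
move=> delta_in pr_l odd_l nld.
have lam2 := legendre_unit (Fp_neg1_neq0 pr_l).
have n0 d : ~~ (l %| d)%N -> d%:Z%:~R != 0 :> 'F_l by rewrite -pmulrn Fp_nat_eq0.
have half_weight : (delta \in [:: 1; 2; 3; 4]%N) ->
    kronecker ((-1) ^+ (12 %/ delta) * delta%:Z ^+ (24 %/ delta)) l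
      = legendre ((-1) ^+ (12 %/ delta)) l.
  move=> delta_in4; rewrite kronecker_odd_prime //.
  have -> : (24 %/ delta = 12 %/ delta * 2)%N.
    by move: delta_in4; rewrite !inE => /or4P[] /eqP ->.
  by rewrite exprM legendre_sqr // rmorphXn expf_neq0 // n0.
have legN4 : kronecker (- 4%:Z) l = legendre (-1) l.
  rewrite kronecker_odd_prime // -[- 4%:Z]/(-1 * 2%:Z ^+ 2) legendre_sqr //.
  by rewrite n0 // dvdn_prime2 //; apply/eqP=> l2; rewrite l2 in odd_l.
rewrite /D_char /D_weight; move: delta_in half_weight.
rewrite !inE; do 5?[case/orP => [/eqP->|]] => /=.
- move/(_ isT) => ->; rewrite [in LHS](_ : (-1) ^+ _ = 1 :> int) // legendre1 expr1n.
  by rewrite sign_expr_odd // (_ : odd _ = false) //; lia.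
- move/(_ isT) => ->; rewrite [in LHS](_ : (-1) ^+ _ = 1 :> int) // legendre1 expr1n.
  by rewrite sign_expr_odd // (_ : odd _ = false) //; lia.
- move/(_ isT) => ->; rewrite [in LHS](_ : (-1) ^+ _ = 1 :> int) // legendre1 expr1n.
  by rewrite sign_expr_odd // (_ : odd _ = false) //; lia.
- move/(_ isT) => ->; rewrite (_ : (-1) ^+ (12 %/ 4) = -1 :> int) //.
  by rewrite sign_expr_odd // [RHS]sign_expr_odd // (_ : odd (_ %/ _) = odd k) //; lia.
- by rewrite legN4.
by move/eqP=> ->; rewrite legN4.
Qed.

Lemma Fp2_neq0 (x : 'F_2) : x != 0 -> x = 1.
Proof. by case: x => [[|[|x]] lt_x2] // _; apply: val_inj. Qed.

(** Modulo 2 both terms of the vanishing criterion are odd. *)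
Lemma D_hecke_eq0_two delta k m t e l : prime l -> l <> 2%N ->
  delta \in [:: 1; 2; 3; 4; 8; 24]%N ->
  ~~ (l %| delta)%N -> (e = 1%N /\ l <> 3%N) \/ e = 3%N ->
  (24 * k = delta * (e * (2 ^ t * (2 ^ m + 1))))%N ->
  legendre (- 2%:Z ^+ m) l = -1 ->
  fps_mod 2 (D_hecke delta k l) =1 (fun=> 0).
Proof.
move=> pr_l l2 delta_in nld eE kE leg.
have d24 : (delta %| 24)%N.
  by move: delta_in; rewrite !inE; do 5?[case/orP => [/eqP->|]] => // /eqP ->.
have odd_l := legendre_odd pr_l leg.
apply: (@D_hecke_eq0 2 delta k m t e l) => //.
rewrite (D_char_weight k delta_in) //.
have l1 : l%:Z%:~R = 1 :> 'F_2.
  apply: Fp2_neq0; rewrite -pmulrn Fp_nat_eq0 // dvdn_prime2 //.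
  by apply/eqP=> /esym.
have lam1 : (legendre (-1) l)%:~R = 1 :> 'F_2.
  by rewrite /legendre (negPf (Fp_neg1_neq0 pr_l)); case: ifP => _; apply: val_inj.
rewrite intrD intrM !rmorphXn /= l1 lam1 !expr1n mulr1.
by apply: val_inj.
Qed.

(** The weight is e (h g + 1) with e odd, so that the character depends only on the
    parity of h g + 1. *)
Lemma D_hecke_eq0_odd p delta k m e l : prime p -> odd p -> prime l -> l <> p ->
  delta \in [:: 1; 2; 3; 4; 8; 24]%N ->
  ~~ (l %| delta)%N -> (e = 1%N /\ l <> 3%N) \/ e = 3%N ->
  (24 * k = delta * (e * (p ^ m + 1)))%N ->
  legendre (- p%:Z ^+ m) l = -1 ->
  fps_mod p (D_hecke delta k l) =1 (fun=> 0).
Proof.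
move=> pr_p odd_p pr_l npl delta_in nld eE kE leg.
have d24 : (delta %| 24)%N.
  by move: delta_in; rewrite !inE; do 5?[case/orP => [/eqP->|]] => // /eqP ->.
have delta0 : (0 < delta)%N by apply: dvdn_gt0 d24.
have odd_l := legendre_odd pr_l leg.
have odd_e : odd e by case: eE => [[->]|->].
have pE : p = (1 + 2 * p./2)%N by rewrite -[LHS]odd_double_half odd_p mul2n.
have [g pmE odd_g] := prime_pow_decomp m pE.
apply: (@D_hecke_eq0 p delta k m 0 e l) => //; first by rewrite mul1n.
have wE : D_weight delta k = (e * (p./2 * g + 1))%N.
  rewrite /D_weight; suff -> : (12 * k = delta * (e * (p./2 * g + 1)))%N by rewrite mulKn.
  by move: kE; rewrite pmE; lia.
rewrite (D_char_weight k delta_in) // wE.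
rewrite [legendre _ _ ^+ _]sign_expr_odd ?legendre_unit ?Fp_neg1_neq0 //.
rewrite oddM odd_e -sign_expr_odd ?legendre_unit ?Fp_neg1_neq0 //.
exact: character_condition pmE odd_g odd_e leg.
Qed.

Lemma dvdn_odd_exp_add1 p m : odd m -> (p + 1 %| p ^ m + 1)%N.
Proof.
rewrite -[m]odd_double_half => odd_m; move: odd_m; rewrite oddD odd_double addbF oddb => ->.
elim: m./2 => [|j IHj]; first by rewrite expn1.
case: p IHj => [|q] IHj; first by rewrite dvd1n.
have eqn : (q.+1 ^ (true + j.+1.*2) + 1 + (q.+1 + 1) * q =
            q.+1 * q.+1 * (q.+1 ^ (true + j.*2) + 1))%N.
  by rewrite doubleS !addnS !expnS; ring.
by rewrite -(dvdn_addl _ (dvdn_mulr q (dvdnn (q.+1 + 1)))) eqn dvdn_mull.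
Qed.

(** * The admissible pairs *)

Definition is_power (p c : nat) : bool := (p ^ logn p c == c)%N.

Definition one_or_three_power (p c : nat) : bool :=
  is_power p c || ((3 %| c) && is_power p (c %/ 3))%N.

(** Makes the existential condition decidable, so that the classifications below
    become finite computations once p is bounded. *)
Lemma one_or_three_powerP p c : prime p ->
  reflect (exists t, (c = p ^ t)%N \/ (c = 3 * p ^ t)%N) (one_or_three_power p c).
Proof.
move=> pr_p; apply: (iffP orP) => [[/eqP <-|/andP[c3 /eqP cE]]|[t [->|->]]].
- by exists (logn p c); left.
- by exists (logn p (c %/ 3)); right; rewrite cE mulnC divnK.
- by left; rewrite /is_power pfactorK.
by right; rewrite dvdn_mulr // mulKn // /is_power pfactorK ?eqxx.
Qed.

Lemma cond_abc_classification delta p :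
  [/\ (delta %| 24)%N, prime p & cond_abc delta p] <->
  (delta, p) \in [:: (1, 2); (1, 7); (1, 23); (2, 3); (2, 11); (3, 7); (4, 5)]%N.
Proof.
split=> [[d24 pr_p [p24 /(one_or_three_powerP _ pr_p) pow npd]]|].
  have le_d : (delta < 25)%N by rewrite ltnS dvdn_leq.
  have le_p : (p < 25)%N.
    rewrite -addn1 (leq_trans (dvdn_leq _ p24)) ?leq_div //.
      by rewrite divn_gt0 ?(dvdn_gt0 _ d24) // dvdn_leq.
    exact: leq_trans (leq_div _ _) _.
  have /allP/(_ delta) : all (fun delta => all (fun p =>
      [&& delta %| 24, prime p, p + 1 %| 24 %/ delta,
          one_or_three_power p ((24 %/ delta) %/ (p + 1)) & ~~ (p %| delta)]%N ==>
      ((delta, p) \in [:: (1, 2); (1, 7); (1, 23); (2, 3); (2, 11); (3, 7); (4, 5)]%N))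
      (iota 0 25)) (iota 0 25) by vm_compute.
  rewrite mem_iota => /(_ le_d)/allP/(_ p); rewrite mem_iota => /(_ le_p)/implyP; apply.
  by rewrite d24 pr_p p24 pow.
have solves t delta' p' : (delta' %| 24)%N -> prime p' -> (p' + 1 %| 24 %/ delta')%N ->
    ((24 %/ delta') %/ (p' + 1) = p' ^ t)%N
      \/ ((24 %/ delta') %/ (p' + 1) = 3 * p' ^ t)%N ->
    ~~ (p' %| delta')%N -> [/\ (delta' %| 24)%N, prime p' & cond_abc delta' p'].
  by move=> ? ? ? tE ?; split=> //; split=> //; exists t.
rewrite !inE !xpair_eqE; do 6?[case/orP => [/andP[/eqP-> /eqP->]|]].
- by apply: (solves 3%N) => //; left.
- by apply: (solves 0%N) => //; right.
- by apply: (solves 0%N) => //; left.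
- by apply: (solves 0%N) => //; right.
- by apply: (solves 0%N) => //; left.
- by apply: (solves 0%N) => //; left.
by move=> /andP[/eqP-> /eqP->]; apply: (solves 0%N) => //; left.
Qed.

(** A prime p > 24 can only occur with t = 0, that is with 24 / d = 1 or 3. *)
Lemma cond_ab_classification d p :
  [/\ (d %| 24)%N, prime p & cond_ab d p] <->
  [\/ (d, p) = (1, 2)%N, (d, p) = (3, 2)%N,
      d = 8%N /\ (prime p /\ (3 <= p)%N)
    | d = 24%N /\ (prime p /\ (5 <= p)%N)].
Proof.
split=> [[d24 pr_p [pow npd]]|].
  have le_d : (d < 25)%N by rewrite ltnS dvdn_leq.
  have [le_p|lt_p] := ltnP p 25.
    move/(one_or_three_powerP _ pr_p): pow => pow.
    have /allP/(_ d) : all (fun d => all (fun p =>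
        [&& d %| 24, prime p, one_or_three_power p (24 %/ d) & ~~ (p %| d)]%N ==>
        [|| (d, p) == (1, 2), (d, p) == (3, 2), (d == 8) && (3 <= p)
          | (d == 24) && (5 <= p)]%N)
      (iota 0 25)) (iota 0 25) by vm_compute.
    rewrite mem_iota => /(_ le_d)/allP/(_ p); rewrite mem_iota => /(_ le_p)/implyP.
    rewrite d24 pr_p pow npd => /(_ isT)/or4P[/eqP|/eqP|/andP[/eqP ? ?]|/andP[/eqP ? ?]].
    + by constructor 1.
    + by constructor 2.
    + by constructor 3.
    by constructor 4.
  have [t powE] := pow; have {pow powE} powE : (24 %/ d = 1 \/ 24 %/ d = 3)%N.
    case: t powE => [|t]; first by rewrite expn0 muln1.
    have leq24 : (24 %/ d <= 24)%N by apply: leq_div.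
    have pt0 : (0 < p ^ t)%N by rewrite expn_gt0 prime_gt0.
    by rewrite expnS; case=> qE; move: leq24; rewrite qE; nia.
  have dE := divnK d24; case: powE => qE; rewrite qE in dE.
    by constructor 4; split; [lia | split=> //; lia].
  by constructor 3; split; [lia | split=> //; lia].
have solves t d' p' : (d' %| 24)%N -> prime p' ->
    (24 %/ d' = p' ^ t)%N \/ (24 %/ d' = 3 * p' ^ t)%N ->
    ~~ (p' %| d')%N -> [/\ (d' %| 24)%N, prime p' & cond_ab d' p'].
  by move=> ? ? tE ?; split=> //; split=> //; exists t.
case=> [[-> ->]|[-> ->]|[-> [pr_p p3]]|[-> [pr_p p5]]].
- by apply: (solves 3%N) => //; right.
- by apply: (solves 3%N) => //; left.
- apply: (solves 0%N) => //; first by right.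
  by rewrite (@Euclid_dvdX 2 3) // dvdn_prime2 // andbT gtn_eqF.
apply: (solves 0%N) => //; first by left.
rewrite (@Euclid_dvdM (2 ^ 3) 3) // (@Euclid_dvdX 2 3) // !dvdn_prime2 // andbT.
by rewrite !gtn_eqF // ltnW // ltnW.
Qed.

(** * Vanishing for the admissible pairs *)

Theorem proposition1p4 (m : nat) (hm : (1 <= m)%N) :
  [/\
      forall delta p : nat, (delta %| 24)%N -> prime p -> odd m ->
        cond_abc delta p ->
        (p + 1 %| p ^ m + 1)%N /\
        forall l : nat, prime l -> l <> p -> ~~ (l %| delta)%N ->
          legendre (- p%:Z) l = -1 ->
          fps_mod p (D_hecke delta (r_ p m) l) =1 (fun=> 0),
      forall delta p : nat,
        [/\ (delta %| 24)%N, prime p & cond_abc delta p] <->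
        (delta, p) \in [:: (1, 2); (1, 7); (1, 23); (2, 3); (2, 11);
                           (3, 7); (4, 5)]%N,
      forall d p : nat, (d %| 24)%N -> prime p -> cond_ab d p ->
        forall l : nat, prime l -> l <> p -> ~~ (l %| d)%N ->
          legendre (- p%:Z ^+ m) l
            = (if odd m then legendre (- p%:Z) l else legendre (-1) l) /\
          (legendre (- p%:Z ^+ m) l = -1 ->
           fps_mod p (D_hecke d (p ^ m + 1) l) =1 (fun=> 0))
    & forall d p : nat,
        [/\ (d %| 24)%N, prime p & cond_ab d p] <->
        [\/ (d, p) = (1, 2)%N, (d, p) = (3, 2)%N,
            d = 8%N /\ (prime p /\ (3 <= p)%N)
          | d = 24%N /\ (prime p /\ (5 <= p)%N)]].
Proof.
split.
- move=> delta p d24 pr_p odd_m abc; have dvd := dvdn_odd_exp_add1 p odd_m.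
  split=> // l pr_l npl nld leg.
  have rE : (r_ p m * (p + 1) = p ^ m + 1)%N by rewrite /r_ divnK.
  have legm : legendre (- p%:Z ^+ m) l = -1 by rewrite legendre_neg_exp // odd_m.
  (* Excludes l = 3 in the cases with e = 1, where p = 2 modulo 3 or 3 | delta. *)
  have l3 : (p %% 3 == 2)%N || (3 %| delta)%N -> l <> 3%N.
    move=> p3 l3; move: nld leg; rewrite l3; case/orP: p3 => [/eqP p3|->] // _.
    by rewrite legendre_neg1_mod3.
  have /cond_abc_classification : [/\ (delta %| 24)%N, prime p & cond_abc delta p] by [].
  rewrite !inE !xpair_eqE => cases.
  move: rE l3 npl pr_p legm nld.
  move: cases; do 6?[case/orP => [/andP[/eqP-> /eqP->]|]]; last move=> /andP[/eqP-> /eqP->];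
    move=> rE l3 npl pr_p legm nld.
  (* The last argument is e, which is 1 or 3; for p = 2 the preceding one is t. *)
  + apply: (@D_hecke_eq0_two 1 _ m 3 1)%N => //; last by rewrite -[(2 ^ 3)%N]/8%N; lia.
    by left; split=> //; apply: (l3 isT).
  + by apply: (@D_hecke_eq0_odd 7 1 _ m 3)%N => //; [right | lia].
  + apply: (@D_hecke_eq0_odd 23 1 _ m 1)%N => //; last by lia.
    by left; split=> //; apply: (l3 isT).
  + by apply: (@D_hecke_eq0_odd 3 2 _ m 3)%N => //; [right | lia].
  + apply: (@D_hecke_eq0_odd 11 2 _ m 1)%N => //; last by lia.
    by left; split=> //; apply: (l3 isT).
  + apply: (@D_hecke_eq0_odd 7 3 _ m 1)%N => //; last by lia.
    by left; split=> //; apply: (l3 isT).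
  apply: (@D_hecke_eq0_odd 5 4 _ m 1)%N => //; last by lia.
  by left; split=> //; apply: (l3 isT).
- exact: cond_abc_classification.
- move=> d p d24 pr_p ab l pr_l npl nld.
  split; first exact: legendre_neg_exp.
  have l3 : (3 %| d)%N -> l <> 3%N by move=> d3 l3; rewrite l3 d3 in nld.
  have /cond_ab_classification : [/\ (d %| 24)%N, prime p & cond_ab d p] by [].
  case=> [[dE pE]|[dE pE]|[dE [_ p3]]|[dE [_ p5]]]; subst d => leg.
  + subst p; apply: (@D_hecke_eq0_two 1 _ m 3 3)%N => //; first by right.
    by rewrite -[(2 ^ 3)%N]/8%N; lia.
  + subst p; apply: (@D_hecke_eq0_two 3 _ m 3 1)%N => //.
      by left; split=> //; apply: (l3 isT).
    by rewrite -[(2 ^ 3)%N]/8%N; lia.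
  + apply: (@D_hecke_eq0_odd p 8 _ m 3)%N => //; [|by right | by lia].
    by case: (even_prime pr_p) => // pE; rewrite pE in p3.
  + apply: (@D_hecke_eq0_odd p 24 _ m 1)%N => //; last by lia.
      by case: (even_prime pr_p) => // pE; rewrite pE in p5.
    by left; split=> //; apply: (l3 isT).
- exact: cond_ab_classification.
Qed.
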